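(* Let $\mathbf{f}\in\mathbf{H}(\mathrm{div})$ and let $\mathbf{u}\in\mathbf{H}_0(\mathrm{curl})$ denote the exact (weak) solution of $\mathrm{curl}(\mu\,\mathrm{curl}\,\mathbf{u})+\kappa\mathbf{u}=\mathbf{f}$ in $\Omega$, $\mathbf{u}\times\mathbf{n}=0$ on $\partial\Omega$, i.e. \[ \mathcal{B}(\mathbf{u},\boldsymbol\psi)=(\mathbf{f},\boldsymbol\psi)_{L^2(\Omega)}\quad\text{for all }\boldsymbol\psi\in\mathbf{H}_0(\mathrm{curl}). \] Then with the coarse part $\mathbf{u}_H:=\pi_H^E(\mathbf{u})$ and the corrector operator $\mathcal{K}:=-\mathcal{G}\circ\mathcal{L}$ it holds \[ H^{-1}\|\mathbf{u}-(\mathrm{id}+\mathcal{K})\mathbf{u}_H\|_{\mathbf{H}(\mathrm{div})'}+\|\mathbf{u}-(\mathrm{id}+\mathcal{K})\mathbf{u}_H\|_{\mathbf{H}(\mathrm{curl})}+\|\mathbf{u}-\mathbf{u}_H\|_{\mathbf{H}(\mathrm{div})'}\le C\,H\,\|\mathbf{f}\|_{\mathbf{H}(\mathrm{div})}. \] Here $C$ only depends on $\alpha$, the mesh regularity and the constants $C_z,C_\theta$ of the regular decomposition stated in the context.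
   Context: Setting: $\Omega\subset\mathbb{R}^3$ is an open, bounded, contractible domain with polyhedral Lipschitz boundary; functions are complex-valued. $\mathbf{H}(\mathrm{curl})=\mathbf{H}(\mathrm{curl},\Omega)=\{\mathbf{v}\in L^2(\Omega,\mathbb{C}^3):\mathrm{curl}\,\mathbf{v}\in L^2\}$ with norm $\|\mathbf{v}\|^2_{\mathbf{H}(\mathrm{curl})}=\|\mathrm{curl}\,\mathbf{v}\|^2_{L^2}+\|\mathbf{v}\|^2_{L^2}$; $\mathbf{H}_0(\mathrm{curl})$ is its subspace with $\mathbf{v}\times\mathbf{n}=0$ on $\partial\Omega$; $\mathbf{H}(\mathrm{div})=\{\mathbf{v}\in L^2(\Omega,\mathbb{C}^3):\mathrm{div}\,\mathbf{v}\in L^2\}$ with graph norm (no boundary condition). For $\mathbf{w}\in L^2(\Omega,\mathbb{C}^3)$, $\|\mathbf{w}\|_{\mathbf{H}(\mathrm{div})'}=\sup\{|\int_\Omega\mathbf{w}\cdot\mathbf{v}\,dx|:\mathbf{v}\in\mathbf{H}(\mathrm{div}),\|\mathbf{v}\|_{\mathbf{H}(\mathrm{div})}=1\}$. Coefficients: $\mu\in L^\infty(\Omega,\mathbb{R}^{3\times3})$, $\kappa\in L^\infty(\Omega,\mathbb{C}^{3\times3})$, \[ \mathcal{B}(\mathbf{v},\boldsymbol\psi)=(\mu\,\mathrm{curl}\,\mathbf{v},\mathrm{curl}\,\boldsymbol\psi)_{L^2(\Omega)}+(\kappa\mathbf{v},\boldsymbol\psi)_{L^2(\Omega)} \] (complex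 $L^2$ inner products), which is continuous, and it is assumed that there is $\alpha>0$ with $|\mathcal{B}(\mathbf{v},\mathbf{v})|\ge\alpha\|\mathbf{v}\|^2_{\mathbf{H}(\mathrm{curl})}$ for all $\mathbf{v}\in\mathbf{H}_0(\mathrm{curl})$. $\mathbf{H}_0(\mathrm{curl})'$ is the space of bounded (antilinear, matching the second slot of $\mathcal{B}$) functionals with the dual norm. $\mathcal{L}:\mathbf{H}_0(\mathrm{curl})\to\mathbf{H}_0(\mathrm{curl})'$ is $\mathcal{L}(\mathbf{v})(\mathbf{w})=\mathcal{B}(\mathbf{v},\mathbf{w})$. Mesh and projection: $\mathcal{T}_H$ is a regular, shape-regular and quasi-uniform partition of $\overline\Omega$ into closed tetrahedra with mesh size $H=\max_T\mathrm{diam}(T)$; for $G\subset\overline\Omega$, $\mathrm{N}(G)$ is the interior of the union of all elements intersecting $\overline{G}$, $\mathrm{N}^1(G)=\mathrm{N}(G)$ and $\mathrm{N}^m(G)=\mathrm{N}(\mathrm{N}^{m-1}(G))$. $\mathring{\mathcal{N}}(\mathcal{T}_H)=\{\mathbf{v}\in\mathbf{H}_0(\mathrm{curl}):\mathbf{v}|_T(\mathbf{x})=\mathbf{a}_T\times\mathbf{x}+\mathbf{b}_T,\ \mathbf{a}_T,\mathbf{b}_T\in\mathbb{C}^3,\ \forall T\in\mathcal{T}_H\}$ is the lowest order Nédélec space, and $\mathring{\mathcal{RT}}(\mathcal{T}_H)$ the lowest order Raviart--Thomas space with vanishing normal trace. $\pi_H^E:\mathbf{H}_0(\mathrm{curl})\to\mathring{\mathcal{N}}(\mathcal{T}_H)$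 is the Falk--Winther projection, specified here by its properties: it is linear, the identity on $\mathring{\mathcal{N}}(\mathcal{T}_H)$, satisfies for all $T\in\mathcal{T}_H$ the bounds $\|\pi_H^E\mathbf{v}\|_{L^2(T)}\le C_\pi(\|\mathbf{v}\|_{L^2(\mathrm{N}(T))}+H\|\mathrm{curl}\,\mathbf{v}\|_{L^2(\mathrm{N}(T))})$ and $\|\mathrm{curl}\,\pi_H^E\mathbf{v}\|_{L^2(T)}\le C_\pi\|\mathrm{curl}\,\mathbf{v}\|_{L^2(\mathrm{N}(T))}$, with $C_\pi$ depending only on the mesh regularity, and there is a linear projection $\pi_H^F:\mathbf{H}_0(\mathrm{div})\to\mathring{\mathcal{RT}}(\mathcal{T}_H)$ with $\mathrm{curl}\,\pi_H^E\mathbf{v}=\pi_H^F(\mathrm{curl}\,\mathbf{v})$. Regular decomposition constants: $C_z,C_\theta$ are the constants, depending only on the mesh regularity, such that for every $\mathbf{v}\in\mathbf{H}_0(\mathrm{curl})$ there are $\mathbf{z}\in H^1_0(\Omega,\mathbb{C}^3)$, $\theta\in H^1_0(\Omega)$ with $\mathbf{v}-\pi_H^E\mathbf{v}=\mathbf{z}+\nabla\theta$ and, for all $T\in\mathcal{T}_H$, $H^{-1}\|\mathbf{z}\|_{L^2(T)}+\|\nabla\mathbf{z}\|_{L^2(T)}\le C_z\|\mathrm{curl}\,\mathbf{v}\|_{L^2(\mathrm{N}^3(T))}$ and $H^{-1}\|\theta\|_{L^2(T)}+\|\nabla\theta\|_{L^2(T)}\le C_\theta(\|\mathbf{v}\|_{L^2(\mathrm{N}^3(T))}+H\|\mathrm{curl}\,\mathbf{v}\|_{L^2(\mathrm{N}^3(T))})$.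 Corrector Green's Operator: $\mathbf{W}:=\ker(\pi_H^E)\subset\mathbf{H}_0(\mathrm{curl})$ (a closed subspace), and $\mathcal{G}:\mathbf{H}_0(\mathrm{curl})'\to\mathbf{W}$ is defined by $\mathcal{B}(\mathcal{G}(\mathbf{F}),\mathbf{w})=\mathbf{F}(\mathbf{w})$ for all $\mathbf{w}\in\mathbf{W}$. *)

(* Defs.v *)
From HB Require Import structures.
From mathcomp Require Import all_boot all_order all_algebra.
From mathcomp Require Import all_classical all_reals all_analysis.
From mathcomp Require Import complex.
Import Order.TTheory GRing.Theory Num.Theory.
Import numFieldNormedType.Exports.

Set Implicit Arguments.
Unset Strict Implicit.
Unset Printing Implicit Defensive.

Local Open Scope classical_set_scope.
Local Open Scope ring_scope.
Local Open Scope complex_scope.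

Section Setting.
Variable R : realType.
Notation C := R[i].

Definition R3 : Type := (R * R * R)%type.

Definition xcoord (i : 'I_3) (x : R3) : R :=
  match val i with 0%N => x.1.1 | 1%N => x.1.2 | _ => x.2 end.

Definition unit_vector (i : 'I_3) : R3 :=
  ((val i == 0%N)%:R, (val i == 1%N)%:R, (val i == 2%N)%:R).

Definition xcoordv (x : R3) : 'cV[R]_3 := \col_i xcoord i x.

(* The library norm on a product is the maximum norm, so the Euclidean distance
   has to be spelled out. *)
Definition edist (x y : R3) : R :=
  Num.sqrt (\sum_(i < 3) (xcoord i x - xcoord i y) ^+ 2).

Definition diam (D : set R3) : R :=
  sup [set r | exists x y, [/\ D x, D y & r = edist x y]].

(* Supremum of the radii of the balls contained in D. *)
Definition inradius (D : set R3) : R :=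
  sup [set r | 0 <= r /\ exists c, [set y | edist c y <= r] `<=` D].

(* Convex hull of those vertices of p whose index lies in A. *)
Definition face (k : nat) (p : 'I_k -> R3) (A : {set 'I_k}) : set R3 :=
  [set x | exists l : 'I_k -> R,
     [/\ forall a, 0 <= l a, forall a, a \notin A -> l a = 0,
         \sum_a l a = 1 & x = \sum_a l a *: p a]].

Definition simplex (k : nat) (p : 'I_k -> R3) : set R3 := face p [set: 'I_k]%SET.

Definition lebesgue3 : {measure set _ -> \bar R} :=
  ((@lebesgue_measure R \x @lebesgue_measure R) \x @lebesgue_measure R)%E.

Definition measurable_on (D : set R3) (f : R3 -> R) : Prop :=
  measurable_fun (U := R)
    (D : set (measurableTypeR R * measurableTypeR R * measurableTypeR R)) f.

Definition contractible (D : set R3) : Prop :=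
  exists (h : R * R3 -> R3) (x0 : R3),
    [/\ D x0, {within `[0, 1]%classic `*` D, continuous h},
        forall t x, 0 <= t <= 1 -> D x -> D (h (t, x)),
        forall x, D x -> h (0, x) = x &
        forall x, D x -> h (1, x) = x0].

(* Topological boundary of D, provided D is open. *)
Definition boundary (D : set R3) : set R3 := closure D `\` D.

(* Near every boundary point, D is the strict epigraph of a Lipschitz function
   in a suitable Cartesian coordinate system. *)
Definition lipschitz_boundary (D : set R3) : Prop :=
  forall p, boundary D p ->
  exists (Q : 'M[R]_3) (g : R -> R -> R) (L : R),
    [/\ Q *m Q^T = 1%:M,
        forall s t s' t', `|g s t - g s' t'| <= L * (`|s - s'| + `|t - t'|) &
        \forall x \near p,
          let y := Q *m xcoordv (x - p) in D x <-> g (y 0 0) (y 1 0) < y 2 0].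

(* The boundary is a finite union of (triangulated) plane polygons. *)
Definition polyhedral_boundary (D : set R3) : Prop :=
  exists (n : nat) (p : 'I_n -> 'I_3 -> R3),
    boundary D = \bigcup_(k in [set: 'I_n]) simplex (p k).

Definition polyhedral_lipschitz_domain (D : set R3) : Prop :=
  [/\ open D, bounded_set D, contractible D,
      polyhedral_boundary D & lipschitz_boundary D].

(* Fields are total functions on R3, of which only the restriction to the open
   set Omega, up to null sets, is meaningful. *)
Notation cfun := (R3 -> C).
Notation vfield := (R3 -> 'cV[C]_3).

Definition csqnorm (m n : nat) (A : 'M[C]_(m, n)) : R :=
  \sum_i \sum_j Normc.normc (A i j) ^+ 2.

Definition scal (f : cfun) : R3 -> 'cV[C]_1 := fun x => \col_i f x.

Definition cintegral (D : set R3) (f : cfun) : C :=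
  (\int[lebesgue3]_(x in D) complex.Re (f x)) +i*
  (\int[lebesgue3]_(x in D) complex.Im (f x)).

Definition dot (u v : 'cV[C]_3) : C := \sum_i u i 0 * v i 0.

Definition cross (u v : 'cV[C]_3) : 'cV[C]_3 :=
  \col_i (u (i + 1) 0 * v (i + 2) 0 - u (i + 2) 0 * v (i + 1) 0).

Definition conjv (u : 'cV[C]_3) : 'cV[C]_3 := map_mx (@conjc R) u.

Definition cposition (x : R3) : 'cV[C]_3 := \col_i (xcoord i x)%:C.

Definition L2 (m n : nat) (Omega : set R3) (f : R3 -> 'M[C]_(m, n)) : Prop :=
  (forall i j, measurable_on Omega (fun x => complex.Re (f x i j)) /\
               measurable_on Omega (fun x => complex.Im (f x i j))) /\
  lebesgue3.-integrable Omega (fun x => (csqnorm (f x))%:E).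

(* Norm of f in L2(D), for D contained in the closure of Omega.  Elements of a
   mesh are closed; their part outside Omega is a null set on which fields carry
   no information, hence the intersection. *)
Definition L2norm (m n : nat) (Omega D : set R3) (f : R3 -> 'M[C]_(m, n)) : R :=
  Num.sqrt (\int[lebesgue3]_(x in D `&` Omega) csqnorm (f x)).

Definition inner (Omega : set R3) (f g : vfield) : C :=
  cintegral Omega (fun x => dot (f x) (conjv (g x))).

Definition Linfty (Omega : set R3) (f : R3 -> R) : Prop :=
  measurable_on Omega f /\
  exists M : R, {ae lebesgue3, forall x, Omega x -> `|f x| <= M}.

Definition pd (i : 'I_3) (f : R3 -> R) : R3 -> R := 'D_(unit_vector i) f.

Fixpoint Ck (k : nat) (f : R3 -> R) : Prop :=
  if k is k'.+1 then
    [/\ continuous f, forall i x, derivable f x (unit_vector i) &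
        forall i, Ck k' (pd i f)]
  else continuous f.

Definition smooth (f : R3 -> R) : Prop := forall k, Ck k f.

Definition test_function (U : set R3) (phi : cfun) : Prop :=
  [/\ smooth (fun x => complex.Re (phi x)),
      smooth (fun x => complex.Im (phi x)) &
      exists K, [/\ compact K, K `<=` U & forall x, ~ K x -> phi x = 0]].

Definition test_field (U : set R3) (phi : vfield) : Prop :=
  forall i, test_function U (fun x => phi x i 0).

Definition cpd (i : 'I_3) (phi : cfun) : cfun := fun x =>
  pd i (fun y => complex.Re (phi y)) x +i* pd i (fun y => complex.Im (phi y)) x.

Definition grad (phi : cfun) : vfield := fun x => \col_i cpd i phi x.

(* Indices are taken in 'I_3, where addition is modulo 3. *)
Definition curl (phi : vfield) : vfield := fun x =>
  \col_i (cpd (i + 1) (fun y => phi y (i + 2) 0) x -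
          cpd (i + 2) (fun y => phi y (i + 1) 0) x).

(* The weak curl, divergence and gradient are unique up to null sets, and an
   element of one of the spaces below is represented by a point of the graph of
   the operator: v in H(curl) is the pair (v, curl v), and so on.  Two elements
   are equal when their first components agree almost everywhere in Omega. *)

Definition curl_green (Omega U : set R3) (v c : vfield) : Prop :=
  forall phi, test_field U phi ->
    cintegral Omega (fun x => dot (c x) (phi x)) =
    cintegral Omega (fun x => dot (v x) (curl phi x)).

Definition div_green (Omega U : set R3) (v : vfield) (d : cfun) : Prop :=
  forall phi, test_function U phi ->
    cintegral Omega (fun x => d x * phi x) =
    - cintegral Omega (fun x => dot (v x) (grad phi x)).

Definition Hcurl (Omega : set R3) : set (vfield * vfield) :=
  [set v | [/\ L2 Omega v.1, L2 Omega v.2 & curl_green Omega Omega v.1 v.2]].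

(* The tangential trace v x n is defined by Green's formula
   int_Omega curl v . phi - int_Omega v . curl phi = int_{bd Omega} (n x v) . phi,
   so it vanishes when the left-hand side does for every phi that is smooth up
   to the boundary. *)
Definition Hcurl0 (Omega : set R3) : set (vfield * vfield) :=
  [set v | Hcurl Omega v /\ curl_green Omega setT v.1 v.2].

Definition Hdiv (Omega : set R3) : set (vfield * cfun) :=
  [set v | [/\ L2 Omega v.1, L2 Omega (scal v.2) &
               div_green Omega Omega v.1 v.2]].

(* Vanishing normal trace, again through Green's formula. *)
Definition Hdiv0 (Omega : set R3) : set (vfield * cfun) :=
  [set v | Hdiv Omega v /\ div_green Omega setT v.1 v.2].

(* Closure in H^1(Omega) of the smooth functions with compact support. *)
Definition H10 (Omega : set R3) : set (cfun * vfield) :=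
  [set t | [/\ L2 Omega (scal t.1), L2 Omega t.2 &
     exists phi : nat -> cfun,
     [/\ forall k, test_function Omega (phi k),
         (fun k => L2norm Omega Omega (scal (phi k - t.1))) @ \oo --> (0 : R) &
         (fun k => L2norm Omega Omega (grad (phi k) - t.2)) @ \oo --> (0 : R)]]].

Definition Hcurl_norm (Omega : set R3) (v : vfield * vfield) : R :=
  Num.sqrt (L2norm Omega Omega v.2 ^+ 2 + L2norm Omega Omega v.1 ^+ 2).

Definition Hdiv_norm (Omega : set R3) (v : vfield * cfun) : R :=
  Num.sqrt (L2norm Omega Omega v.1 ^+ 2 + L2norm Omega Omega (scal v.2) ^+ 2).

Definition Hdiv_dual_norm (Omega : set R3) (w : vfield) : R :=
  sup [set r | exists v, [/\ Hdiv Omega v, Hdiv_norm Omega v = 1 &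
         r = Normc.normc (cintegral Omega (fun x => dot (w x) (v.1 x)))]].

Definition form (Omega : set R3) (mu : R3 -> 'M[R]_3) (kappa : R3 -> 'M[C]_3)
    (v psi : vfield * vfield) : C :=
  inner Omega (fun x => map_mx (real_complex R) (mu x) *m v.2 x) psi.2 +
  inner Omega (fun x => kappa x *m v.1 x) psi.1.

Definition coefficients (Omega : set R3) (mu : R3 -> 'M[R]_3)
    (kappa : R3 -> 'M[C]_3) : Prop :=
  forall i j, [/\ Linfty Omega (fun x => mu x i j),
    Linfty Omega (fun x => complex.Re (kappa x i j)) &
    Linfty Omega (fun x => complex.Im (kappa x i j))].

Definition coercive (Omega : set R3) (mu : R3 -> 'M[R]_3)
    (kappa : R3 -> 'M[C]_3) (alpha : R) : Prop :=
  forall v, Hcurl0 Omega v ->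
    alpha * Hcurl_norm Omega v ^+ 2 <= Normc.normc (form Omega mu kappa v v).

Definition Hcurl0_dual (Omega : set R3) : set (vfield * vfield -> C) :=
  [set F | (forall a v w, Hcurl0 Omega v -> Hcurl0 Omega w ->
              F (a *: v + w) = conjc a * F v + F w) /\
           exists M : R, forall v, Hcurl0 Omega v ->
              Normc.normc (F v) <= M * Hcurl_norm Omega v].

Section Mesh.
Variables (I : finType) (vert : I -> 'I_4 -> R3).

Definition elt (i : I) : set R3 := simplex (vert i).

Definition mesh_size : R := \big[Num.max/0]_(i : I) diam (elt i).

Definition common_vertices (i j : I) : {set 'I_4} :=
  [set a | [exists b, vert i a == vert j b]]%SET.

(* Regular (conforming) partition of the closure of Omega: two distinct elements
   are disjoint or share a vertex, an edge or a face. *)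
Definition regular_partition (Omega : set R3) : Prop :=
  [/\ forall i, (elt i)° !=set0,
      closure Omega = \bigcup_(i in [set: I]) elt i,
      forall i j, i != j -> (elt i)° `&` (elt j)° = set0 &
      forall i j, i != j ->
        elt i `&` elt j = face (vert i) (common_vertices i j)].

Definition shape_regular (c : R) : Prop :=
  forall i, diam (elt i) <= c * (2 * inradius (elt i)).

Definition quasi_uniform (c : R) : Prop :=
  forall i, mesh_size <= c * diam (elt i).

Definition patch (G : set R3) : set R3 :=
  (\bigcup_(i in [set i | elt i `&` closure G !=set0]) elt i)°.

Definition npatch (m : nat) (G : set R3) : set R3 := iter m patch G.

Definition nedelec0 (Omega : set R3) : set (vfield * vfield) :=
  [set v | Hcurl0 Omega v /\ forall i, exists a b : 'cV[C]_3,
     {ae lebesgue3, forall x, (elt i `&` Omega) x ->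
        v.1 x = cross a (cposition x) + b}].

Definition raviart_thomas0 (Omega : set R3) : set (vfield * cfun) :=
  [set v | Hdiv0 Omega v /\ forall i, exists (a : C) (b : 'cV[C]_3),
     {ae lebesgue3, forall x, (elt i `&` Omega) x ->
        v.1 x = a *: cposition x + b}].

(* P is a linear projection of the space V onto its subspace S; since elements
   of V are representatives, all identities hold almost everywhere. *)
Definition linear_projection (A : lmodType C) (Omega : set R3)
    (V S : set (vfield * (R3 -> A)))
    (P : vfield * (R3 -> A) -> vfield * (R3 -> A)) : Prop :=
  [/\ forall v, V v -> S (P v),
      forall v w, V v -> V w ->
        ae_eq lebesgue3 Omega v.1 w.1 -> ae_eq lebesgue3 Omega (P v).1 (P w).1,
      forall a v w, V v -> V w ->
        ae_eq lebesgue3 Omega (P (a *: v + w)).1 (a *: (P v).1 + (P w).1) &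
      forall v, S v -> ae_eq lebesgue3 Omega (P v).1 v.1].

(* The divergence-free field curl v of H_0(div) is
   represented by the pair (curl v, 0). *)
Definition falk_winther (Omega : set R3) (Cpi : R)
    (piE : vfield * vfield -> vfield * vfield) : Prop :=
  [/\ linear_projection Omega (Hcurl0 Omega) (nedelec0 Omega) piE,
      forall v i, Hcurl0 Omega v ->
        L2norm Omega (elt i) (piE v).1 <=
          Cpi * (L2norm Omega (patch (elt i)) v.1 +
                 mesh_size * L2norm Omega (patch (elt i)) v.2),
      forall v i, Hcurl0 Omega v ->
        L2norm Omega (elt i) (piE v).2 <=
          Cpi * L2norm Omega (patch (elt i)) v.2 &
      exists piF : vfield * cfun -> vfield * cfun,
        linear_projection (A := C^o) Omega
          (Hdiv0 Omega) (raviart_thomas0 Omega) piF /\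
        forall v, Hcurl0 Omega v ->
          ae_eq lebesgue3 Omega (piE v).2 (piF (v.2, 0)).1].

Definition regular_decomposition (Omega : set R3) (Cz Ctheta : R)
    (piE : vfield * vfield -> vfield * vfield) : Prop :=
  forall v, Hcurl0 Omega v ->
  exists (z : vfield) (Dz : R3 -> 'M[C]_3) (theta : cfun) (Dtheta : vfield),
    [/\ forall k, H10 Omega (fun x => z x k 0, fun x => (row k (Dz x))^T),
        H10 Omega (theta, Dtheta),
        ae_eq lebesgue3 Omega (v.1 - (piE v).1) (z + Dtheta),
        forall i,
          mesh_size^-1 * L2norm Omega (elt i) z + L2norm Omega (elt i) Dz <=
            Cz * L2norm Omega (npatch 3 (elt i)) v.2 &
        forall i,
          mesh_size^-1 * L2norm Omega (elt i) (scal theta) +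
          L2norm Omega (elt i) Dtheta <=
            Ctheta * (L2norm Omega (npatch 3 (elt i)) v.1 +
                      mesh_size * L2norm Omega (npatch 3 (elt i)) v.2)].

End Mesh.

Definition kernelW (Omega : set R3)
    (piE : vfield * vfield -> vfield * vfield) : set (vfield * vfield) :=
  [set w | Hcurl0 Omega w /\ ae_eq lebesgue3 Omega (piE w).1 0].

(* G F is determined up to null sets by these conditions when the form is
   coercive on H_0(curl). *)
Definition corrector_green (Omega : set R3) (mu : R3 -> 'M[R]_3)
    (kappa : R3 -> 'M[C]_3) (piE : vfield * vfield -> vfield * vfield)
    (G : (vfield * vfield -> C) -> vfield * vfield) : Prop :=
  forall F, Hcurl0_dual Omega F ->
    kernelW Omega piE (G F) /\
    forall w, kernelW Omega piE w -> form Omega mu kappa (G F) w = F w.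

(* - G o L, where the operator L is v |-> form v, i.e. L(v)(w) = B(v, w). *)
Definition corrector (Omega : set R3) (mu : R3 -> 'M[R]_3)
    (kappa : R3 -> 'M[C]_3) (G : (vfield * vfield -> C) -> vfield * vfield)
    (v : vfield * vfield) : vfield * vfield :=
  - G (form Omega mu kappa v).

Definition weak_solution (Omega : set R3) (mu : R3 -> 'M[R]_3)
    (kappa : R3 -> 'M[C]_3) (f : vfield) (u : vfield * vfield) : Prop :=
  Hcurl0 Omega u /\
  forall psi, Hcurl0 Omega psi -> form Omega mu kappa u psi = inner Omega f psi.1.

End Setting.

Notation cfun R := (R3 R%type -> R[i]) (only parsing).
Notation vfield R := (R3 R%type -> 'cV[R[i]]_3) (only parsing).

(* Main.v *)
Require Import Defs.
From mathcomp Require Import all_boot all_order all_algebra.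
From mathcomp Require Import all_classical all_reals all_analysis.
From mathcomp Require Import complex measurable_realfun zify ring lra.
Import Order.TTheory GRing.Theory Num.Theory.
Import numFieldNormedType.Exports.

Local Open Scope classical_set_scope.
Local Open Scope ring_scope.
Local Open Scope complex_scope.

Set Implicit Arguments.
Unset Strict Implicit.
Unset Printing Implicit Defensive.

(** The constant must not depend on the size of Omega, the number of elements or the upper bounds of
    mu and kappa. The continuity constant of B therefore never enters an estimate: coercivity is
    applied to e and to u alone, and the data enter only through (f, e) and (f, u).

    The power of H is gained twice for e. Its pairing with g costs H times its H(curl) norm, and
    that norm is itself O(H) because the same pairing with g built from f controls B(e, e). For u -
    u_H only the first gain is available, since u is merely bounded by stability; this is why only
    the dual norm of e carries the factor 1/H. The conjugate of f is forced by a mismatch: B and the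
    inner product conjugate their second argument, while the pairing in the dual norm is bilinear.

    Fields are representatives modulo null sets. Hence pi e = 0, idempotence of pi and the regular
    decomposition are only identities almost everywhere, and they are used under integrals. *)

(** The error e = u - (id + K) u_H lies in W = ker pi, and since
    B(K u_H, w) = - B(u_H, w) for w in W, it satisfies B(e, e) = (f, e).  Writing
    v - pi v = z + grad theta and integrating grad theta by parts against g in H(div)
    gives |(v - pi v, g)| <= C H |v|_{H(curl)} |g|_{H(div)}.  For v = e and g the
    conjugate of f this is, by coercivity, the bound of e in H(curl); for v = e and
    v = u with arbitrary g it bounds the two dual norms.

    The local bounds of z and theta are summed with the bounded overlap of the patches
    N^3(T): every element contains a ball of radius proportional to H, hence in its
    interior a point of a grid of spacing proportional to H; these points are distinct
    for distinct elements, and only boundedly many of them lie within 4 H of a point. *)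

(** * Borel sets of R^3 *)

Lemma ball3P (R : realType) (x y : R3 R) (r : R) :
  ball x r y <->
  [/\ `|x.1.1 - y.1.1| < r, `|x.1.2 - y.1.2| < r & `|x.2 - y.2| < r].
Proof. by split=> [[[]]|[]]. Qed.

Definition R3_measurable (R : realType) :=
  (measurableTypeR R * measurableTypeR R * measurableTypeR R)%type.

Lemma measurable_ball3 (R : realType) (x : R3 R) (r : R) :
  measurable (ball x r : set (R3_measurable R)).
Proof.
have -> : (ball x r : set (R3_measurable R)) =
    (ball x.1.1 r `*` ball x.1.2 r) `*` ball x.2 r by [].
by apply: measurableX; [apply: measurableX|]; exact: (open_measurable (ball_open _ _)).
Qed.

Lemma rat_near (R : realType) (x e : R) : 0 < e -> exists q, `|ratr q - x| < e.
Proof.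
move=> e0; have /rat_in_itvoo[q /itvP qx] : x - e < x + e by lra.
by exists q; rewrite ltr_distl !qx.
Qed.

(** The sigma-algebra on [R3] is generated by products, so it has to be related to the topology: an
    open set is the union of the countably many boxes with rational centre and radius 1/(n+1) that
    it contains, enumerated by [unpickle]. *)
Lemma open_measurable3 (R : realType) (A : set (R3 R)) :
  open A -> measurable (A : set (R3_measurable R)).
Proof.
move=> oA.
pose box (q : rat * rat * rat * nat) : set (R3 R) :=
  ball (ratr q.1.1.1 : R, ratr q.1.1.2 : R, ratr q.1.2 : R) (q.2.+1%:R^-1 : R).
pose F k := if @unpickle (rat * rat * rat * nat)%type k is Some q then
  (if `[< box q `<=` A >] then box q else set0) else set0.
suff -> : A = \bigcup_k F k.
  apply: bigcupT_measurable => k; rewrite /F.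
  case: unpickle => [q|]; last exact: measurable0.
  by case: ifP => _; [exact: measurable_ball3|exact: measurable0].
apply/seteqP; split => [x Ax|x [k _]]; last first.
  by rewrite /F; case: unpickle => [q|//]; case: asboolP => // + ; exact.
have [e /= e0 eA] : \forall e \near 0^'+, ball x e `<=` A.
  by apply: open_subball.
have {e e0 eA} [e e0 eA] : exists2 e, 0 < e & ball x e `<=` A.
  exists (e / 2); first by rewrite divr_gt0.
  apply: eA; last by rewrite divr_gt0.
  by rewrite /= sub0r normrN gtr0_norm ?divr_gt0// ltr_pdivrMr// ltr_pMr// ltr1n.
(* The factor 2 leaves room for both the radius of the box and the distance from [x] to its rational
   centre. *)
have [n ne] : exists n : nat, 2 * n.+1%:R^-1 < e.
  have /ltr_add_invr[n] : 0 < e / 2 by lra.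
  by rewrite add0r ltr_pdivlMr// mulrC; exists n.
pose d : R := n.+1%:R^-1.
have d0 : 0 < d by rewrite invr_gt0.
have [q1 h1] := rat_near x.1.1 d0; have [q2 h2] := rat_near x.1.2 d0.
have [q3 h3] := rat_near x.2 d0.
have [k kE] : exists k, unpickle k = Some (q1, q2, q3, n).
  by eexists; exact: pickleK.
exists k; first exact: I.
rewrite /F kE.
case: asboolP => [_|]; first by apply/ball3P.
case=> y /ball3P /= [y1 y2 y3]; apply: eA; apply/ball3P; rewrite -/d in y1 y2 y3.
rewrite -/d in ne.
by split; rewrite distrC;
  apply: le_lt_trans ne; rewrite mulr2n mulrDl mul1r;
  [apply: le_trans (ler_distD (ratr q1) _ _) _
  |apply: le_trans (ler_distD (ratr q2) _ _) _
  |apply: le_trans (ler_distD (ratr q3) _ _) _];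
  apply: lerD; apply: ltW; rewrite // distrC.
Qed.

Lemma closed_measurable3 (R : realType) (A : set (R3 R)) :
  closed A -> measurable (A : set (R3_measurable R)).
Proof. by move/closed_openC/open_measurable3/measurableC; rewrite setCK. Qed.

Lemma continuous_measurable_on (R : realType) (D : set (R3 R)) (f : R3 R -> R) :
  open D -> continuous f -> measurable_on D f.
Proof.
move=> oD cf.
apply: (@measurability _ _ _ _ _ _ (@RGenOpens.G R)).
  exact: RGenOpens.measurableE.
move=> _ [_ [a [b ->]] <-].
apply: (@open_measurable3 R); apply: openI => //.
by apply: open_comp => [x _|]; [exact: cf|exact: interval_open].
Qed.

(** * Boxes, simplices and diameters *)

Section Geometry.
Variable R : realType.
Implicit Types (x y c : R3 R) (D : set (R3 R)).

Lemma ball_xcoordP x y (r : R) :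
  ball x r y <-> forall k, `|xcoord k x - xcoord k y| < r.
Proof.
rewrite ball3P; split=> [[h0 h1 h2] [[|[|[|//]]] //]|h].
by split; [have := h ord0|have := h (inord 1)|have := h (inord 2)];
  rewrite /xcoord /= ?inordK.
Qed.

Lemma xcoord_continuous k : continuous (@xcoord R k).
Proof.
move=> x; rewrite /continuous_at /xcoord; case: (val k) => [|[|_]].
- apply: (@continuous_comp _ _ _ fst fst); exact: cvg_fst.
- apply: (@continuous_comp _ _ _ fst snd); [exact: cvg_fst|exact: cvg_snd].
- exact: cvg_snd.
Qed.

(** The sharp factor is the square root of 3, rounded up to 2. *)
Lemma sqrt_sum_le (a : 'I_3 -> R) (s : R) :
  0 <= s -> (forall k, `|a k| <= s) -> Num.sqrt (\sum_k a k ^+ 2) <= 2 * s.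
Proof.
move=> s0 h.
rewrite -(@ger0_norm _ (2 * s)) ?mulr_ge0// -sqrtr_sqr ler_wsqrtr//.
apply: (@le_trans _ _ (\sum_(k < 3) s ^+ 2)).
  by apply: ler_sum => k _; rewrite -ler_sqrt ?sqr_ge0// !sqrtr_sqr (ger0_norm s0).
by rewrite sumr_const card_ord; nra.
Qed.

Lemma edist_le x y (s : R) : 0 <= s ->
  (forall k, `|xcoord k x - xcoord k y| <= s) -> Defs.edist x y <= 2 * s.
Proof. exact: sqrt_sum_le. Qed.

Lemma xcoord_le_edist x y k : `|xcoord k x - xcoord k y| <= Defs.edist x y.
Proof.
rewrite /Defs.edist -sqrtr_sqr ler_wsqrtr// (bigD1 k)//= lerDl.
by apply: sumr_ge0 => i _; exact: sqr_ge0.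
Qed.

(** A closed cube, so that the closure taken in [patch] does not enlarge it. *)
Definition box3 c (r : R) : set (R3 R) :=
  [set x | forall k, `|xcoord k x - xcoord k c| <= r].

Lemma closed_box3 c r : closed (box3 c r).
Proof.
have -> : box3 c r = \bigcap_k (fun x => xcoord k x - xcoord k c) @^-1` `[- r, r].
  apply/seteqP; split=> [x h k _|x h k].
    by have := h k; rewrite /= in_itv /= ler_norml.
  by have := h k I; rewrite /= in_itv /= ler_norml.
apply: closed_bigI => k _; apply: preimage_closed => [x _|]; last exact: itv_closed.
by apply: cvgB; [exact: xcoord_continuous|exact: cvg_cst].
Qed.

Lemma compact_box3 c r : compact (box3 c r).
Proof.
pose K : set (R3 R) := (`[c.1.1 - r, c.1.1 + r] `*` `[c.1.2 - r, c.1.2 + r]) `*`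
  `[c.2 - r, c.2 + r].
apply: (@subclosed_compact _ _ K); first exact: closed_box3.
  by do 2?apply: compact_setX; exact: segment_compact.
move=> x h; have := (h ord0, h (inord 1), h (inord 2)).
rewrite /xcoord /= !inordK// !ler_distl => -[[h0 h1] h2].
by split; [split|]; rewrite /= in_itv /=.
Qed.

Lemma bounded_sub_box3 D : bounded_set D -> exists M, D `<=` box3 0 M.
Proof.
move=> [M [_ /(_ (M + 1))]]; rewrite ltrDl ltr01 => /(_ isT) DM.
exists (M + 1) => x /DM /=.
rewrite prod_normE ge_max prod_normE ge_max => /andP[/andP[h0 h1] h2].
by move=> [[|[|[|//]]] //] i; rewrite /xcoord /= subr0.
Qed.

Lemma continuous_bounded_on D (f : R3 R -> R) : bounded_set D -> continuous f ->
  exists M, forall x, D x -> `|f x| <= M.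
Proof.
move=> /bounded_sub_box3[r Dr] cf.
have : compact (f @` box3 0 r).
  apply: continuous_compact; last exact: compact_box3.
  exact: continuous_subspaceT.
move=> /compact_bounded[M [_ /(_ (M + 1))]]; rewrite ltrDl ltr01 => /(_ isT) h.
by exists (M + 1) => x Dx; apply: h; exists x => //; exact: Dr.
Qed.

(** A simplex is the continuous image of the set of its barycentric coordinates, which is closed and
    bounded in ['rV[R]_k]. *)
Lemma compact_simplex k (p : 'I_k -> R3 R) : compact (simplex p).
Proof.
pose L : set 'rV[R]_k := [set l | (forall a, 0 <= l 0 a) /\ \sum_a l 0 a = 1].
pose F (l : 'rV[R]_k) : R3 R := \sum_a l 0 a *: p a.
have -> : simplex p = F @` L.
  apply/seteqP; split => [x [l [l0 _ l1 ->]]|x [l [l0 l1] <-]].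
    exists (\row_a l a); last by apply: eq_bigr => a _; rewrite mxE.
    split=> [a|]; first by rewrite mxE.
    by rewrite -[RHS]l1; apply: eq_bigr => a _; rewrite mxE.
  by exists (fun a => l 0 a); split => // a; rewrite inE.
apply: continuous_compact.
  apply: continuous_subspaceT.
  apply: continuous_big => [|a _]; first exact: add_continuous.
  move=> l; apply: cvgZr_tmp; first exact: (nbhs_filter l).
  exact: (@coord_continuous R 1 k 0 a l).
apply: bounded_closed_compact.
  exists 1; split => // M M1 l [l0 l1] /=.
  apply: le_trans (ltW M1); rewrite [`|l|]mx_normrE; apply: bigmax_le => // -[i j] _ /=.
  rewrite ord1 ger0_norm// -l1 (bigD1 j)//= lerDl; exact: sumr_ge0.
have -> : L = (\bigcap_a (fun l : 'rV[R]_k => l 0 a) @^-1` `[0, +oo[) `&`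
    (fun l : 'rV[R]_k => \sum_a l 0 a) @^-1` [set 1].
  apply/seteqP; split => [l [l0 l1]|l [l0 l1]]; split => //= a.
    by move=> _; rewrite /= in_itv /= andbT.
  by have := l0 a I; rewrite /= in_itv /= andbT.
apply: closedI.
  apply: closed_bigI => a _; apply: preimage_closed => [l _|]; first exact: coord_continuous.
  exact: interval_closed.
apply: preimage_closed => [l _|]; last exact: closed_eq.
apply: continuous_big => [|a _]; first exact: add_continuous.
exact: coord_continuous.
Qed.

Lemma closed_simplex k (p : 'I_k -> R3 R) : closed (simplex p).
Proof. by apply: compact_closed; [exact: norm_hausdorff|exact: compact_simplex]. Qed.

Lemma edist_le_diam D x y : bounded_set D -> D x -> D y -> Defs.edist x y <= diam D.
Proof.
move=> /bounded_sub_box3[M DM] Dx Dy; apply: ub_le_sup; last by exists x, y.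
exists (2 * (2 * `|M|)) => _ [u [v [/DM u0 /DM v0 ->]]].
apply: edist_le => [|k]; first by rewrite mulr_ge0.
have := u0 k; have := v0 k; have := ler_norm M.
have -> : xcoord k (0 : R3 R) = 0 by rewrite /xcoord; case: (val k) => [|[]].
rewrite !subr0 => h1 h2 h3; apply: le_trans (ler_normB _ _) _; lra.
Qed.

Lemma diam_gt0 D : bounded_set D -> D° !=set0 -> 0 < diam D.
Proof.
move=> bD [x xD].
have [e /= e0 eD] := (nbhs_ballP _ _).1 xD.
pose y : R3 R := (x.1.1 + e / 2, x.1.2, x.2).
have xy : Defs.edist x y = e / 2.
  rewrite /Defs.edist !big_ord_recl big_ord0 /xcoord /=.
  rewrite !subrr expr0n /= !addr0 opprD addNKr sqrrN sqrtr_sqr.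
  by rewrite ger0_norm// divr_ge0// ltW.
have e20 : 0 < e / 2 by rewrite divr_gt0.
apply: (lt_le_trans e20); rewrite -xy; apply: edist_le_diam => //.
  by apply: eD; exact: ballxx.
apply: eD; apply/ball3P; rewrite /= !subrr normr0 opprD addNKr normrN.
by split => //; rewrite gtr0_norm// ltr_pdivrMr// ltr_pMr// ltr1n.
Qed.

End Geometry.

(** * Bounded overlap of the element patches *)

Lemma ord3_ind (P : 'I_3 -> Prop) :
  P ord0 -> P (inord 1) -> P (inord 2) -> forall k, P k.
Proof.
move=> P0 P1 P2 [[|[|[|//]]] hk].
- by rewrite (_ : Ordinal hk = ord0); last exact: val_inj.
- by rewrite (_ : Ordinal hk = inord 1); last by apply: val_inj; rewrite /= inordK.
- by rewrite (_ : Ordinal hk = inord 2); last by apply: val_inj; rewrite /= inordK.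
Qed.

(** With grid spacing s = H / (8 [c_shape] [c_unif]), the distance 4 H equals 32 [c_shape] [c_unif]
    s. So [N] exceeds 4 H / s, and each coordinate of a grid index takes at most 2 N + 1 values. *)
Definition overlap_bound (R : realType) (c_shape c_unif : R) : nat :=
  let N := (Num.truncn (32 * (c_shape * c_unif))).+1 in ((2 * N).+1 ^ 3)%N.

Section Mesh.
Variables (R : realType) (I : finType) (vert : I -> 'I_4 -> R3 R).
Implicit Types (x y c : R3 R) (G : set (R3 R)).

Lemma bounded_elt i : bounded_set (elt vert i).
Proof. exact/compact_bounded/compact_simplex. Qed.

Lemma diam_le_mesh_size i : diam (elt vert i) <= mesh_size vert.
Proof. exact: le_bigmax. Qed.

Lemma xcoord_elt_le i x y k : elt vert i x -> elt vert i y ->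
  `|xcoord k x - xcoord k y| <= mesh_size vert.
Proof.
move=> xi yi; apply: le_trans (xcoord_le_edist _ _ _) _.
apply: le_trans (diam_le_mesh_size i).
exact: edist_le_diam (bounded_elt i) _ _.
Qed.

Lemma patch_sub_box3 G c r : G `<=` box3 c r ->
  Defs.patch vert G `<=` box3 c (r + mesh_size vert).
Proof.
move=> Gr y /interior_subset[i /= [z [iz Gz]] iy] k.
have /(_ k) zc : box3 c r z by apply: closed_box3; exact: closureS Gr _ Gz.
have := xcoord_elt_le k iy iz.
by have := ler_distD (xcoord k z) (xcoord k y) (xcoord k c); lra.
Qed.

Lemma npatch_elt_sub_box3 m i c : elt vert i c ->
  npatch vert m (elt vert i) `<=` box3 c (m.+1%:R * mesh_size vert).
Proof.
move=> ic; elim: m => [|m IH].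
  by move=> x ix k; rewrite mul1r; exact: xcoord_elt_le ix ic.
rewrite -[m.+2]addn1 natrD mulrDl mul1r; exact: patch_sub_box3.
Qed.

Lemma open_npatch m i : open (npatch vert m.+1 (elt vert i)).
Proof. exact: open_interior. Qed.

Lemma overlap_le Omega (c_shape c_unif : R) x :
  regular_partition vert Omega -> shape_regular vert c_shape ->
  quasi_uniform vert c_unif ->
  (#|[set i | `[< npatch vert 3 (elt vert i) x >]]%SET| <=
    overlap_bound c_shape c_unif)%N.
Proof.
move=> [int0 _ disj _] shape unif.
set H := mesh_size vert; set A := [set i | _]%SET.
have [->|[i0 i0A]] := set_0Vmem A; first by rewrite cards0.
have dgt0 i : 0 < diam (elt vert i) by exact: diam_gt0 (bounded_elt i) (int0 i).
have H0 : 0 < H by apply: lt_le_trans (dgt0 i0) (diam_le_mesh_size i0).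
(* The default value of [sup] is 0 on empty and on unbounded sets, so the sign is known in every
   case. *)
have inr0 i : 0 <= inradius (elt vert i).
  rewrite /inradius; set S := [set r | _].
  have [->|/set0P[r rD]] := eqVneq S set0; first by rewrite sup0.
  have [ub|nub] := pselect (has_ubound S).
    by apply: le_trans (ub_le_sup ub rD); case: rD.
  by rewrite sup_out// => -[].
have cs0 : 0 < c_shape by have := shape i0; have := dgt0 i0; have := inr0 i0; nra.
have cu0 : 0 < c_unif by have := unif i0; have := dgt0 i0; rewrite -/H; nra.
set kap := 4 * (c_shape * c_unif).
have kap0 : 0 < kap by rewrite !mulr_gt0.
pose s := H / (2 * kap).
have s0 : 0 < s by rewrite divr_gt0// mulr_gt0.
have Hs : H = 2 * kap * s by rewrite /s mulrC divfK// gt_eqF// mulr_gt0.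
have /choice[c cP] : forall i, exists c, box3 c s `<=` elt vert i.
  move=> i.
  (* The supremum need not be attained, so a strict bound is needed to obtain an actual ball. The
     regularity hypotheses give even 4 s, and a ball of radius 2 s contains the cube of half side s
     by [edist_le]. *)
  have : 2 * s < inradius (elt vert i).
    have := shape i; have := unif i; rewrite -/H Hs /kap => h1 h2.
    have h3 := le_trans h1 (ler_wpM2l (ltW cu0) h2).
    have : 4 * s <= inradius (elt vert i).
      by rewrite -(ler_pM2l (mulr_gt0 cs0 cu0)); lra.
    lra.
  move=> /sup_gt[|r [_ [c cr]] sr].
    apply/set0P/negP => /eqP e; have := shape i; rewrite /inradius e sup0 !mulr0.
    by rewrite leNgt dgt0.
  exists c => y yc; apply: cr => /=; apply: le_trans (ltW sr).
  by apply: edist_le (ltW s0) _ => k; rewrite distrC.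
(* The grid is anchored at [x]; [t i] is the centre of the cube inside element [i] in grid units,
   and its floor is the index of the grid point assigned to [i]. *)
pose t i k := (xcoord k (c i) - xcoord k x) / s.
have ct i : elt vert i (c i).
  by apply: cP => k; rewrite subrr normr0 ltW.
pose N := (Num.truncn (32 * (c_shape * c_unif))).+1.
have NP : 8 * kap < N%:R.
  by rewrite /kap mulrA -natrM; exact: truncnS_gt.
have tN i k : i \in A -> `|t i k| < N%:R.
  rewrite inE => /asboolP/(npatch_elt_sub_box3 (ct i))/(_ k).
  rewrite distrC -/H Hs => h; apply: le_lt_trans NP.
  rewrite normrM normfV (gtr0_norm s0) ler_pdivrMr//; apply: le_trans h _; nra.
(* For [i] in [A] the shifted floor lies between 0 and 2 N, so neither [absz] nor [inord] loses
   information there. *)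
pose idx i k : 'I_(2 * N).+1 := inord (absz (Num.floor (t i k) + N%:Z)%R).
have idxP i j k : i \in A -> j \in A -> idx i k = idx j k ->
    Num.floor (t i k) = Num.floor (t j k).
  have fl l : l \in A -> 0 <= Num.floor (t l k) + N%:Z /\ Num.floor (t l k) <= N%:Z.
    move=> /(tN _ k); rewrite ltr_norml => /andP[h1 h2].
    split; first by rewrite -lerBlDr sub0r floor_ge_int mulrNz ltW.
    by rewrite -(ler_int R); apply: le_trans (floor_le _) (ltW _).
  move=> /fl[i1 i2] /fl[j1 j2] /(congr1 val).
  rewrite /= !inordK; [|lia..].
  lia.
pose g i : 'I_(2 * N).+1 * 'I_(2 * N).+1 * 'I_(2 * N).+1 :=
  (idx i ord0, idx i (inord 1), idx i (inord 2)).
rewrite -(card_in_imset (f := g)); last first.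
  move=> i j iA jA [e0 e1 e2]; apply/eqP/negPn/negP => ij.
  have fe k : Num.floor (t i k) = Num.floor (t j k).
    by elim/ord3_ind: k; exact: idxP.
  (* If [i] and [j] share an index, this grid point differs by less than s in each coordinate from
     both centres. It is then interior to both elements, against their disjointness. *)
  pose z : R3 R := (x.1.1 + s * (Num.floor (t i ord0))%:~R,
    x.1.2 + s * (Num.floor (t i (inord 1)))%:~R,
    x.2 + s * (Num.floor (t i (inord 2)))%:~R).
  have zE k : xcoord k z = xcoord k x + s * (Num.floor (t i k))%:~R.
    by elim/ord3_ind: k; rewrite /xcoord /= ?inordK.
  have zint l : l \in A -> (forall k, Num.floor (t l k) = Num.floor (t i k)) ->
      (elt vert l)° z.
    move=> lA lE; apply/nbhs_ballP.
    have bz : ball (c l) s z.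
      apply/ball_xcoordP => k; rewrite zE -lE.
      have -> : xcoord k (c l) = xcoord k x + s * t l k.
        by rewrite /t mulrC divfK ?gt_eqF// addrC subrK.
      rewrite opprD addrACA subrr add0r -mulrBr normrM (gtr0_norm s0) gtr_pMr//.
      have /andP[] := floor_itv (t l k); rewrite intrD => h1 h2.
      by rewrite ger0_norm ?subr_ge0// ltrBlDl.
    have /nbhs_ballP[e e0' eb] := open_nbhs_nbhs (conj (ball_open (c l) s) bz).
    exists e => // y /eb /ball_xcoordP h; apply: cP => k.
    by rewrite distrC ltW.
  have : ((elt vert i)° `&` (elt vert j)°) z by split; apply: zint.
  by rewrite disj.
apply: leq_trans (max_card _) _.
by rewrite !card_prod card_ord /overlap_bound -/N -mulnA.
Qed.

End Mesh.

(** * Complex-valued integrals *)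

Section Integration.
Variable R : realType.
Notation C := R[i].
Notation Re := complex.Re.
Notation Im := complex.Im.
Notation normc := Normc.normc.
Notation leb := (lebesgue3 R).

Lemma ReD (x y : C) : Re (x + y) = Re x + Re y. Proof. by case: x y => ? ? []. Qed.
Lemma ImD (x y : C) : Im (x + y) = Im x + Im y. Proof. by case: x y => ? ? []. Qed.
Lemma ReM (x y : C) : Re (x * y) = Re x * Re y - Im x * Im y.
Proof. by case: x y => ? ? []. Qed.
Lemma ImM (x y : C) : Im (x * y) = Re x * Im y + Im x * Re y.
Proof. by case: x y => ? ? []. Qed.
Lemma ReJ (x : C) : Re (conjc x) = Re x. Proof. by case: x. Qed.
Lemma ImJ (x : C) : Im (conjc x) = - Im x. Proof. by case: x. Qed.
Lemma complexP (x y : C) : Re x = Re y -> Im x = Im y -> x = y.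
Proof. by case: x y => ? ? [] ? ? /= -> ->. Qed.

Lemma sqr_normcE (x : C) : normc x ^+ 2 = Re x ^+ 2 + Im x ^+ 2.
Proof. by case: x => a b /=; rewrite sqr_sqrtr// addr_ge0// sqr_ge0. Qed.

Lemma normc_ge0 (x : C) : 0 <= normc x.
Proof. by case: x => a b /=; rewrite sqrtr_ge0. Qed.

Lemma normc_conj (x : C) : normc (conjc x) = normc x.
Proof. by case: x => a b /=; rewrite sqrrN. Qed.

Lemma csqnorm_ge0 m n (A : 'M[C]_(m, n)) : 0 <= csqnorm A.
Proof. by do 2 (apply: sumr_ge0 => ? _); exact: sqr_ge0. Qed.

Lemma lebesgue3_bounded_lty (D : set (R3 R)) :
  measurable (D : set (R3_measurable R)) -> bounded_set D -> (leb D < +oo)%E.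
Proof.
move=> mD /bounded_sub_box3[M DM].
pose K : set (R3_measurable R) := (`[- M, M] `*` `[- M, M]) `*` `[- M, M].
have mI : measurable (`[- M, M]%classic : set (measurableTypeR R)).
  exact: measurable_itv.
apply: (@le_lt_trans _ _ (leb K)).
  apply: le_measure; rewrite ?inE//.
    by apply: measurableX => //; exact: measurableX.
  move=> x /DM h; have := (h ord0, h (inord 1), h (inord 2)).
  rewrite /xcoord /= !inordK// !subr0 !ler_norml => -[[h0 h1] h2].
  by split; [split|]; rewrite /= in_itv /=.
rewrite /lebesgue3 /K /= product_measure1E//; last exact: measurableX.
rewrite /= product_measure1E//.
have fI : (@lebesgue_measure R `[- M, M]%classic) \is a fin_num.
  by rewrite lebesgue_measure_itv /=; case: ifP.
have fK := fin_numM (fin_numM fI fI) fI.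
by move: fK; rewrite ge0_fin_numE// ?mule_ge0.
Qed.

Lemma lebesgue3_ae_filter : Filter (nbhs (almost_everywhere leb)).
Proof. exact: (ae_filter_ringOfSetsType leb). Qed.

Section Domain.
Variables (Omega : set (R3 R)) (oO : open Omega).

Let mO : measurable (Omega : set (R3_measurable R)).
Proof. exact: open_measurable3. Qed.

Definition rintegrable (f : R3 R -> R) : Prop := leb.-integrable Omega (EFin \o f).

Definition cintegrable (f : R3 R -> C) : Prop :=
  rintegrable (fun x => Re (f x)) /\ rintegrable (fun x => Im (f x)).

Definition csquare_int (f : R3 R -> C) : Prop :=
  [/\ measurable_on Omega (fun x => Re (f x)),
      measurable_on Omega (fun x => Im (f x)) &
      rintegrable (fun x => normc (f x) ^+ 2)].

Lemma rintegrable_measurable f : rintegrable f -> measurable_on Omega f.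
Proof. by move=> /(measurable_int leb)/measurable_EFinP. Qed.

Lemma rintegrableD f g : rintegrable f -> rintegrable g -> rintegrable (fun x => f x + g x).
Proof. by move=> f1 g1; have := integrableD mO f1 g1. Qed.

Lemma rintegrableZ a f : rintegrable f -> rintegrable (fun x => a * f x).
Proof. by move=> f1; have := integrableZl mO a f1. Qed.

Lemma rintegrable_sum (J : Type) (s : seq J) (f : J -> R3 R -> R) :
  (forall j, rintegrable (f j)) -> rintegrable (fun x => \sum_(j <- s) f j x).
Proof.
move=> h; elim: s => [|j s IH].
  under [X in rintegrable X]funext do rewrite big_nil.
  exact: (@integrable0 _ _ _ leb).
by under [X in rintegrable X]funext do rewrite big_cons; apply: rintegrableD.
Qed.

Lemma rintegrable_dom f g : measurable_on Omega f -> rintegrable g ->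
  (forall x, Omega x -> `|f x| <= g x) -> rintegrable f.
Proof.
move=> mf ig fg; apply: (le_integrable mO _ _ ig); first exact/measurable_EFinP.
by move=> x /fg h; rewrite /= lee_fin (le_trans h)// ler_norm.
Qed.

Lemma cintegrableD f g : cintegrable f -> cintegrable g -> cintegrable (fun x => f x + g x).
Proof.
move=> [f1 f2] [g1 g2]; split.
  by under [X in rintegrable X]funext do rewrite ReD; exact: rintegrableD.
by under [X in rintegrable X]funext do rewrite ImD; exact: rintegrableD.
Qed.

Lemma cintegrableZ a f : cintegrable f -> cintegrable (fun x => a * f x).
Proof.
move=> [f1 f2]; split.
  under [X in rintegrable X]funext do rewrite ReM -mulNr.
  by apply: rintegrableD; exact: rintegrableZ.
by under [X in rintegrable X]funext do rewrite ImM; apply: rintegrableD; exact: rintegrableZ.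
Qed.

Lemma cintegralD f g : cintegrable f -> cintegrable g ->
  cintegral Omega (fun x => f x + g x) = cintegral Omega f + cintegral Omega g.
Proof.
move=> [f1 f2] [g1 g2]; apply: complexP; rewrite ?ReD ?ImD /cintegral /=.
  by rewrite -RintegralD//; apply: eq_Rintegral => x _; rewrite ReD.
by rewrite -RintegralD//; apply: eq_Rintegral => x _; rewrite ImD.
Qed.

Lemma cintegralZ a f : cintegrable f ->
  cintegral Omega (fun x => a * f x) = a * cintegral Omega f.
Proof.
move=> [f1 f2]; apply: complexP; rewrite ?ReM ?ImM /cintegral /=.
  rewrite -!RintegralZl// -RintegralB//; [|exact: rintegrableZ..].
  by apply: eq_Rintegral => x _; rewrite ReM.
rewrite -!RintegralZl// -RintegralD//; [|exact: rintegrableZ..].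
by apply: eq_Rintegral => x _; rewrite ImM.
Qed.

Lemma cintegralJ f : cintegrable f ->
  cintegral Omega (fun x => conjc (f x)) = conjc (cintegral Omega f).
Proof.
move=> [f1 f2]; apply: complexP; rewrite ?ReJ ?ImJ /cintegral /=.
  by apply: eq_Rintegral => x _; rewrite ReJ.
rewrite -mulN1r -RintegralZl//.
by apply: eq_Rintegral => x _; rewrite ImJ mulN1r.
Qed.

Lemma eq_cintegral f g : (forall x, Omega x -> f x = g x) ->
  cintegral Omega f = cintegral Omega g.
Proof.
move=> fg; rewrite /cintegral.
by congr (_ +i* _); apply: eq_Rintegral => x /set_mem /fg ->.
Qed.

Lemma ae_eq_cintegral f g : cintegrable f -> cintegrable g -> ae_eq leb Omega f g ->
  cintegral Omega f = cintegral Omega g.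
Proof.
move=> [/rintegrable_measurable f1 /rintegrable_measurable f2].
move=> [/rintegrable_measurable g1 /rintegrable_measurable g2] fg.
rewrite /cintegral /Rintegral; congr (fine _ +i* fine _);
  apply: ae_eq_integral => //; try exact/measurable_EFinP.
  exact: (ae_eq_comp (fun z : C => (Re z)%:E) fg).
exact: (ae_eq_comp (fun z : C => (Im z)%:E) fg).
Qed.

(** Both components of the product are dominated by |f|^2 + |g|^2. *)
Lemma csquare_intM f g : csquare_int f -> csquare_int g ->
  cintegrable (fun x => f x * g x).
Proof.
move=> [f1 f2 f3] [g1 g2 g3]; have fg3 := rintegrableD f3 g3; split.
  under [X in rintegrable X]funext do rewrite ReM.
  apply: (rintegrable_dom _ fg3) => [|x _].
    by apply: measurable_funB; exact: measurable_funM.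
  rewrite !sqr_normcE.
  have := sqr_ge0 (Re (f x) - Re (g x)); have := sqr_ge0 (Re (f x) + Re (g x)).
  have := sqr_ge0 (Im (f x) - Im (g x)); have := sqr_ge0 (Im (f x) + Im (g x)).
  have := sqr_ge0 (Re (f x)); have := sqr_ge0 (Im (f x)).
  have := sqr_ge0 (Re (g x)); have := sqr_ge0 (Im (g x)).
  by rewrite ler_norml => *; apply/andP; split; lra.
under [X in rintegrable X]funext do rewrite ImM.
apply: (rintegrable_dom _ fg3) => [|x _].
  by apply: measurable_funD; exact: measurable_funM.
rewrite !sqr_normcE.
have := sqr_ge0 (Re (f x) - Im (g x)); have := sqr_ge0 (Re (f x) + Im (g x)).
have := sqr_ge0 (Im (f x) - Re (g x)); have := sqr_ge0 (Im (f x) + Re (g x)).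
have := sqr_ge0 (Re (f x)); have := sqr_ge0 (Im (f x)).
have := sqr_ge0 (Re (g x)); have := sqr_ge0 (Im (g x)).
by rewrite ler_norml => *; apply/andP; split; lra.
Qed.

Lemma measurable_sqr_normc f :
  measurable_on Omega (fun x => Re (f x)) ->
  measurable_on Omega (fun x => Im (f x)) ->
  measurable_on Omega (fun x => normc (f x) ^+ 2).
Proof.
move=> f1 f2; under [X in measurable_on _ X]funext do rewrite sqr_normcE.
by apply: measurable_funD; exact: measurable_funX.
Qed.

Lemma csquare_intD f g : csquare_int f -> csquare_int g ->
  csquare_int (fun x => f x + g x).
Proof.
move=> [f1 f2 f3] [g1 g2 g3].
have m1 : measurable_on Omega (fun x => Re (f x + g x)).
  by under [X in measurable_on _ X]funext do rewrite ReD; exact: measurable_funD.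
have m2 : measurable_on Omega (fun x => Im (f x + g x)).
  by under [X in measurable_on _ X]funext do rewrite ImD; exact: measurable_funD.
split => //; apply: (rintegrable_dom _ (rintegrableZ 2 (rintegrableD f3 g3))).
  exact: measurable_sqr_normc.
move=> x _; rewrite ger0_norm ?sqr_ge0// !sqr_normcE ReD ImD.
have := sqr_ge0 (Re (f x) - Re (g x)); have := sqr_ge0 (Im (f x) - Im (g x)).
by move=> *; lra.
Qed.

Lemma csquare_intZ a f : csquare_int f -> csquare_int (fun x => a * f x).
Proof.
move=> [f1 f2 f3]; split.
- under [X in measurable_on _ X]funext do rewrite ReM.
  by apply: measurable_funB; apply: measurable_funM => //; exact: measurable_cst.
- under [X in measurable_on _ X]funext do rewrite ImM.
  by apply: measurable_funD; apply: measurable_funM => //; exact: measurable_cst.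
- under [X in rintegrable X]funext do rewrite Normc.normcM exprMn; exact: rintegrableZ.
Qed.

Lemma csquare_intJ f : csquare_int f -> csquare_int (fun x => conjc (f x)).
Proof.
move=> [f1 f2 f3]; split.
- by under [X in measurable_on _ X]funext do rewrite ReJ.
- under [X in measurable_on _ X]funext do rewrite ImJ.
  exact: (measurable_funN f2).
- by under [X in rintegrable X]funext do rewrite normc_conj.
Qed.

Lemma csquare_int0 : csquare_int (fun=> 0).
Proof.
split; [exact: measurable_cst|exact: measurable_cst|].
under [X in rintegrable X]funext do rewrite Normc.normc0 expr0n.
exact: (@integrable0 _ _ _ leb).
Qed.

Lemma csquare_int_sum (J : Type) (s : seq J) (f : J -> R3 R -> C) :
  (forall j, csquare_int (f j)) -> csquare_int (fun x => \sum_(j <- s) f j x).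
Proof.
move=> h; elim: s => [|j s IH].
  by under [X in csquare_int X]funext do rewrite big_nil; exact: csquare_int0.
by under [X in csquare_int X]funext do rewrite big_cons; exact: csquare_intD.
Qed.

Lemma csquare_int_Linfty (k f : R3 R -> C) :
  Linfty Omega (fun x => Re (k x)) -> Linfty Omega (fun x => Im (k x)) ->
  csquare_int f -> csquare_int (fun x => k x * f x).
Proof.
move=> [k1 [M1 hM1]] [k2 [M2 hM2]] [f1 f2 f3].
have m1 : measurable_on Omega (fun x => Re (k x * f x)).
  under [X in measurable_on _ X]funext do rewrite ReM.
  by apply: measurable_funB; apply: measurable_funM.
have m2 : measurable_on Omega (fun x => Im (k x * f x)).
  under [X in measurable_on _ X]funext do rewrite ImM.
  by apply: measurable_funD; apply: measurable_funM.
split => //; have m3 := measurable_sqr_normc m1 m2.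
(* The bounds of [k] hold only almost everywhere, so the pointwise domination of [rintegrable_dom]
   is replaced by a comparison of integrals. *)
apply/integrableP; split; first exact/measurable_EFinP.
have /integrableP[mg gfin] := rintegrableZ (M1 ^+ 2 + M2 ^+ 2) f3.
apply: le_lt_trans gfin; apply: ae_ge0_le_integral => //.
- by apply: measurableT_comp => //; exact/measurable_EFinP.
- exact: measurableT_comp.
have ? := lebesgue3_ae_filter; move: hM1 hM2; apply: filterS2 => x h1 h2 Ox /=; rewrite lee_fin.
rewrite [leLHS]ger0_norm ?sqr_ge0//; apply: le_trans (ler_norm _).
rewrite Normc.normcM exprMn ler_wpM2r ?sqr_ge0// sqr_normcE.
have {}h1 := h1 Ox; have {}h2 := h2 Ox.
by apply: lerD; rewrite -real_normK ?num_real// ler_sqr ?nnegrE ?(le_trans _ h1) ?(le_trans _ h2).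
Qed.

Lemma csquare_int_cont (f : R3 R -> C) : bounded_set Omega ->
  continuous (fun x => Re (f x)) -> continuous (fun x => Im (f x)) ->
  csquare_int f.
Proof.
move=> bO c1 c2.
have m1 := continuous_measurable_on oO c1.
have m2 := continuous_measurable_on oO c2.
split => //.
have [M1 h1] := continuous_bounded_on bO c1.
have [M2 h2] := continuous_bounded_on bO c2.
apply: (@rintegrable_dom _ (fun=> M1 ^+ 2 + M2 ^+ 2)); first exact: measurable_sqr_normc.
  apply: measurable_bounded_integrable => //; first exact: lebesgue3_bounded_lty.
  by exists (`|M1 ^+ 2 + M2 ^+ 2|); split => // r hr y _; exact: ltW.
move=> x Ox; rewrite ger0_norm ?sqr_ge0// sqr_normcE.
apply: lerD; rewrite -real_normK ?num_real// ler_sqr ?nnegrE;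
  by rewrite ?h1 ?h2// ?(le_trans _ (h1 _ Ox))// ?(le_trans _ (h2 _ Ox)).
Qed.

End Domain.
End Integration.

(** * L2 pairings and Green's formulas *)

Section VectorFields.
Variable R : realType.
Notation C := R[i].
Notation Re := complex.Re.
Notation Im := complex.Im.
Notation normc := Normc.normc.
Notation leb := (lebesgue3 R).

(* [dot] is the case [n = 3]; the case [n = 1] covers the pairings of scalar
   functions. *)
Definition bdot n (u v : 'cV[C]_n) : C := \sum_i u i 0 * v i 0.

Lemma cpdJ i (phi : cfun R) x : smooth (fun y => Im (phi y)) ->
  cpd i (fun y => conjc (phi y)) x = conjc (cpd i phi x).
Proof.
move=> /(_ 1%N)[_ /(_ i x) dphi _]; apply: complexP; rewrite ?ReJ ?ImJ /cpd /=.
  by congr (pd _ _ _); apply/funext => y; rewrite ReJ.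
under [X in pd _ X]funext do rewrite ImJ.
by rewrite /pd; have := deriveN dphi.
Qed.

Lemma gradJ (phi : cfun R) x : smooth (fun y => Im (phi y)) ->
  grad (fun y => conjc (phi y)) x = conjv (grad phi x).
Proof. by move=> sphi; apply/matrixP => i j; rewrite !mxE cpdJ. Qed.

Lemma CkN k (g : R3 R -> R) : Ck k g -> Ck k (fun x => - g x).
Proof.
elim: k g => [|k IH] g /=; first by move=> cg x; apply: cvgN; exact: cg.
move=> [cg dg Cg]; split => [x|i x|i]; first by apply: cvgN; exact: cg.
  exact/derivableN/dg.
rewrite (_ : pd i _ = (fun x => - pd i g x)); first exact: IH.
by apply/funext => x; have := deriveN (dg i x).
Qed.

Lemma test_functionJ U (phi : cfun R) :
  test_function U phi -> test_function U (fun x => conjc (phi x)).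
Proof.
move=> [h1 h2 [K [cK KU K0]]]; split.
- by under [X in smooth X]funext do rewrite ReJ.
- under [X in smooth X]funext do rewrite ImJ.
  by move=> k; exact/CkN.
- by exists K; split => // x /K0 ->; rewrite conjc0.
Qed.

(** With w = a + ib the left-hand side is 2 Re (w u.v), and the bound expands |w u - conj v|^2 >= 0
    entrywise. It is the pointwise form of Cauchy-Schwarz, free of products of norms and hence ready
    to be integrated. *)
Lemma bdot_re_le n (u v : 'cV[C]_n) (a b : R) :
  2 * (a * Re (bdot u v) - b * Im (bdot u v)) <=
  (a ^+ 2 + b ^+ 2) * csqnorm u + csqnorm v.
Proof.
have -> : Re (bdot u v) = \sum_i Re (u i 0 * v i 0).
  by exact: (big_morph (@complex.Re R) (@ReD R) erefl).
have -> : Im (bdot u v) = \sum_i Im (u i 0 * v i 0).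
  by exact: (big_morph (@complex.Im R) (@ImD R) erefl).
rewrite /csqnorm !mulr_sumr -sumrB mulr_sumr -big_split /=.
apply: ler_sum => i _; rewrite !big_ord1 !sqr_normcE ReM ImM.
move: (Re (u i 0)) (Im (u i 0)) (Re (v i 0)) (Im (v i 0)) => p q r s.
have := sqr_ge0 (a * p - b * q - r); have := sqr_ge0 (a * q + b * p + s).
by nra.
Qed.

Lemma csqnorm_conjv u : csqnorm (conjv u : 'cV[C]_3) = csqnorm u.
Proof.
by apply: eq_bigr => i _; apply: eq_bigr => j _; rewrite mxE normc_conj.
Qed.

Section Domain.
Variables (Omega : set (R3 R)) (oO : open Omega) (bO : bounded_set Omega).

Let mO : measurable (Omega : set (R3_measurable R)).
Proof. exact: open_measurable3. Qed.

Lemma L2P m n (f : R3 R -> 'M[C]_(m, n)) :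
  L2 Omega f <-> forall i j, csquare_int Omega (fun x => f x i j).
Proof.
split=> [[mf If] i j|h].
  have [m1 m2] := mf i j; split => //.
  apply: (rintegrable_dom oO _ If); first exact: measurable_sqr_normc.
  move=> x _; rewrite ger0_norm ?sqr_ge0// /csqnorm (bigD1 i)//= (bigD1 j)//=.
  rewrite -addrA lerDl addr_ge0// sumr_ge0// => k _; rewrite ?sqr_ge0//.
  by apply: sumr_ge0 => l _; exact: sqr_ge0.
split=> [i j|]; first by have [] := h i j.
apply: rintegrable_sum => // i; apply: rintegrable_sum => // j; by have [] := h i j.
Qed.

Lemma L2_csqnorm m n (f : R3 R -> 'M[C]_(m, n)) :
  L2 Omega f -> rintegrable Omega (fun x => csqnorm (f x)).
Proof. by case. Qed.

Lemma sqr_L2norm m n (f : R3 R -> 'M[C]_(m, n)) D :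
  L2norm Omega D f ^+ 2 = \int[leb]_(x in D `&` Omega) csqnorm (f x).
Proof. by rewrite sqr_sqrtr// Rintegral_ge0// => x _; exact: csqnorm_ge0. Qed.

Lemma sqr_L2norm_total m n (f : R3 R -> 'M[C]_(m, n)) :
  L2norm Omega Omega f ^+ 2 = \int[leb]_(x in Omega) csqnorm (f x).
Proof. by rewrite sqr_L2norm setIid. Qed.

Lemma L2norm_ge0 m n (f : R3 R -> 'M[C]_(m, n)) D : 0 <= L2norm Omega D f.
Proof. exact: sqrtr_ge0. Qed.

Lemma L2D m n (f g : R3 R -> 'M[C]_(m, n)) :
  L2 Omega f -> L2 Omega g -> L2 Omega (fun x => f x + g x).
Proof.
move=> /L2P f2 /L2P g2; apply/L2P => i j.
by under [X in csquare_int _ X]funext do rewrite mxE; exact: csquare_intD.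
Qed.

Lemma L2Z m n a (f : R3 R -> 'M[C]_(m, n)) :
  L2 Omega f -> L2 Omega (fun x => a *: f x).
Proof.
move=> /L2P f2; apply/L2P => i j.
by under [X in csquare_int _ X]funext do rewrite mxE; exact: csquare_intZ.
Qed.

Lemma L2B m n (f g : R3 R -> 'M[C]_(m, n)) :
  L2 Omega f -> L2 Omega g -> L2 Omega (fun x => f x - g x).
Proof.
move=> f2 g2; under [X in L2 _ X]funext do rewrite -[- _]scaleN1r.
by apply: L2D => //; exact: L2Z.
Qed.

Lemma L2J (f : vfield R) : L2 Omega f -> L2 Omega (fun x => conjv (f x)).
Proof.
move=> /L2P f2; apply/L2P => i j.
by under [X in csquare_int _ X]funext do rewrite mxE; exact: csquare_intJ.
Qed.

Lemma L2_scal (f : cfun R) : L2 Omega (scal f) <-> csquare_int Omega f.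
Proof.
rewrite L2P; split=> [/(_ 0 0)|h i j].
  by under [X in csquare_int _ X]funext do rewrite mxE.
by under [X in csquare_int _ X]funext do rewrite mxE.
Qed.

Lemma L2norm_conjv (f : vfield R) D :
  L2norm Omega D (fun x => conjv (f x)) = L2norm Omega D f.
Proof.
rewrite /L2norm; congr Num.sqrt; apply: eq_Rintegral => x _.
exact: csqnorm_conjv.
Qed.

Lemma L2norm_scal_conj (f : cfun R) D :
  L2norm Omega D (scal (fun x => conjc (f x))) = L2norm Omega D (scal f).
Proof.
rewrite /L2norm; congr Num.sqrt; apply: eq_Rintegral => x _.
by rewrite /csqnorm !big_ord1 !mxE normc_conj.
Qed.

Lemma cintegrable_bdot n (f g : R3 R -> 'cV[C]_n) :
  L2 Omega f -> L2 Omega g -> cintegrable Omega (fun x => bdot (f x) (g x)).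
Proof.
move=> /L2P f2 /L2P g2; rewrite /bdot.
elim: (index_enum _) => [|i s IH].
  under [X in cintegrable _ X]funext do rewrite big_nil.
  by split; exact: (@integrable0 _ _ _ leb).
under [X in cintegrable _ X]funext do rewrite big_cons.
by apply: cintegrableD => //; exact: csquare_intM.
Qed.

Lemma bdotDl n (u v w : 'cV[C]_n) : bdot (u + v) w = bdot u w + bdot v w.
Proof. by rewrite /bdot -big_split; apply: eq_bigr => i _; rewrite mxE mulrDl. Qed.

Lemma bdotZl n a (u w : 'cV[C]_n) : bdot (a *: u) w = a * bdot u w.
Proof. by rewrite /bdot mulr_sumr; apply: eq_bigr => i _; rewrite mxE mulrA. Qed.

Lemma bdotC n (u v : 'cV[C]_n) : bdot u v = bdot v u.
Proof. by apply: eq_bigr => i _; rewrite mulrC. Qed.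

Lemma cintegral_bdot_lin n a (f f' g : R3 R -> 'cV[C]_n) :
  L2 Omega f -> L2 Omega f' -> L2 Omega g ->
  cintegral Omega (fun x => bdot (a *: f x + f' x) (g x)) =
  a * cintegral Omega (fun x => bdot (f x) (g x)) +
  cintegral Omega (fun x => bdot (f' x) (g x)).
Proof.
move=> f2 f'2 g2.
rewrite -cintegralZ//; last exact: cintegrable_bdot.
rewrite -cintegralD//; [|exact/cintegrableZ/cintegrable_bdot|exact: cintegrable_bdot].
by apply: eq_cintegral => x _; rewrite bdotDl bdotZl.
Qed.

Lemma cauchy_schwarz n (f g : R3 R -> 'cV[C]_n) : L2 Omega f -> L2 Omega g ->
  normc (cintegral Omega (fun x => bdot (f x) (g x))) <=
  L2norm Omega Omega f * L2norm Omega Omega g.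
Proof.
move=> f2 g2; set J := cintegral _ _.
have [c1 c2] := cintegrable_bdot f2 g2.
have fi := L2_csqnorm f2; have gi := L2_csqnorm g2.
have key a b : 2 * (a * Re J - b * Im J) <=
    (a ^+ 2 + b ^+ 2) * L2norm Omega Omega f ^+ 2 + L2norm Omega Omega g ^+ 2.
  rewrite !sqr_L2norm_total /J /= -!RintegralZl// -RintegralD//;
    last exact: rintegrableZ.
  rewrite -RintegralB//; [|exact: rintegrableZ..].
  rewrite -RintegralZl//; last first.
    under [X in leb.-integrable _ X]funext => x do
      rewrite /= -[X in (_ - X)%:E]opprK opprK -mulNr.
    by apply: rintegrableD => //; exact: rintegrableZ.
  apply: le_Rintegral => //; last by move=> x _; exact: bdot_re_le.
    apply: rintegrableZ => //.
    under [X in rintegrable _ X]funext do rewrite -mulNr.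
    by apply: rintegrableD => //; exact: rintegrableZ.
  by apply: rintegrableD => //; exact: rintegrableZ.
set A := L2norm _ _ f in key *; set B := L2norm _ _ g in key *.
have A0 : 0 <= A by exact: L2norm_ge0.
have B0 : 0 <= B by exact: L2norm_ge0.
set m := Re J ^+ 2 + Im J ^+ 2.
have m0 : 0 <= m by rewrite addr_ge0// sqr_ge0.
(* The multiplier a + ib is t times the conjugate of [J], which turns the real part into t |J|^2. *)
have {}key t : 2 * t * m <= t ^+ 2 * m * A ^+ 2 + B ^+ 2.
  have := key (t * Re J) (- t * Im J); rewrite /m; lra.
suff mAB : m <= (A * B) ^+ 2.
  rewrite -ler_sqr ?nnegrE ?normc_ge0 ?mulr_ge0//.
  by rewrite sqr_normcE.
have [A_0|A_0] := eqVneq A 0.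
  rewrite A_0 mul0r expr0n/=; have [//|m_gt0] := leP m 0.
  (* For A = 0 the bound reads 2 t m <= B^2 for all t; this t makes the left-hand side 2 (B^2 +
     1). *)
  have := key ((B ^+ 2 + 1) / m); rewrite A_0 expr0n/= mulr0 add0r.
  rewrite -mulrA divfK ?gt_eqF//; have := sqr_ge0 B; lra.
have A2 : 0 < A ^+ 2 by rewrite exprn_gt0// lt_neqAle eq_sym A_0.
(* The optimal choice of t in the quadratic inequality. *)
have := key (A ^- 2); have -> : A ^- 2 ^+ 2 * m * A ^+ 2 = A ^- 2 * m.
  by field.
rewrite -mulrA exprMn => h.
have : A ^- 2 * m <= B ^+ 2 by lra.
by rewrite ler_pdivrMl.
Qed.

Lemma csquare_int_test (phi : cfun R) :
  test_function setT phi -> csquare_int Omega phi.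
Proof.
by move=> [h1 h2 _]; apply: csquare_int_cont => //; [exact: (h1 0%N)|exact: (h2 0%N)].
Qed.

Lemma csquare_int_cpd i (phi : cfun R) :
  test_function setT phi -> csquare_int Omega (cpd i phi).
Proof.
move=> [/(_ 1%N)[_ _ h1] /(_ 1%N)[_ _ h2] _].
by apply: csquare_int_cont => //; [exact: h1|exact: h2].
Qed.

Lemma test_functionT U (phi : cfun R) : test_function U phi -> test_function setT phi.
Proof. by move=> [h1 h2 [K [cK _ K0]]]; split => //; exists K; split. Qed.

Lemma L2_test U (phi : vfield R) : test_field U phi -> L2 Omega phi.
Proof.
move=> h; apply/L2P => i j; rewrite ord1.
exact/csquare_int_test/test_functionT/h.
Qed.

Lemma L2_curl_test U (phi : vfield R) : test_field U phi -> L2 Omega (curl phi).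
Proof.
move=> h; apply/L2P => i j.
under [X in csquare_int _ X]funext do rewrite mxE -mulN1r.
apply: csquare_intD => //; last apply: csquare_intZ => //;
  by apply: csquare_int_cpd; exact/test_functionT/h.
Qed.

Lemma L2_grad_test U (phi : cfun R) : test_function U phi -> L2 Omega (grad phi).
Proof.
move=> h; apply/L2P => i j.
under [X in csquare_int _ X]funext do rewrite mxE.
exact/csquare_int_cpd/test_functionT/h.
Qed.

Lemma curl_green_lin U a (v c v' c' : vfield R) :
  L2 Omega v -> L2 Omega c -> L2 Omega v' -> L2 Omega c' ->
  curl_green Omega U v c -> curl_green Omega U v' c' ->
  curl_green Omega U (a *: v + v') (a *: c + c').
Proof.
move=> v2 c2 v'2 c'2 g g' phi tphi.
have := cintegral_bdot_lin a c2 c'2 (L2_test tphi).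
have := cintegral_bdot_lin a v2 v'2 (L2_curl_test tphi).
by rewrite -/(dot _ _) => e1 e2; rewrite [LHS]e2 [RHS]e1 (g _ tphi) (g' _ tphi).
Qed.

Lemma Hcurl0_lin a v w :
  Hcurl0 Omega v -> Hcurl0 Omega w -> Hcurl0 Omega (a *: v + w).
Proof.
move=> [[v1 v2 gv] gv'] [[w1 w2 gw] gw']; split; last exact: curl_green_lin.
split; last exact: curl_green_lin.
  by apply: L2D => //; exact: L2Z.
by apply: L2D => //; exact: L2Z.
Qed.

(** Green's formula for the conjugate field is the conjugate of the formula for [f], tested with the
    conjugate of [phi]. *)
Lemma HdivJ (f : vfield R * cfun R) : Hdiv Omega f ->
  Hdiv Omega (fun x => conjv (f.1 x), fun x => conjc (f.2 x)).
Proof.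
move=> [f1 f2 gf]; split => /=; first exact: L2J.
  by apply/L2_scal/csquare_intJ/L2_scal.
move=> phi tphi; have tphi' := test_functionJ tphi.
have [_ sphi _] := tphi.
have cf2 := (L2_scal _).1 f2.
have := gf _ tphi'.
have conjcN (z : C) : conjc (- z) = - conjc z by case: z.
move/(congr1 (@conjc R)); rewrite conjcN -!(cintegralJ oO);
  [|exact: (cintegrable_bdot f1 (L2_grad_test tphi'))
   |by apply: csquare_intM => //; exact/csquare_int_test/test_functionT/tphi'].
move=> e; rewrite (_ : cintegral _ _ = cintegral Omega
    (fun x => conjc (f.2 x * conjc (phi x)))); last first.
  by apply: eq_cintegral => x _; rewrite rmorphM /= conjcK.
rewrite e; congr (- _); apply: eq_cintegral => x _.
rewrite /dot rmorph_sum; apply: eq_bigr => i _.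
by rewrite rmorphM /= gradJ// !mxE conjcK.
Qed.

Lemma Hdiv_normJ (f : vfield R * cfun R) :
  Hdiv_norm Omega (fun x => conjv (f.1 x), fun x => conjc (f.2 x)) =
  Hdiv_norm Omega f.
Proof. by rewrite /Hdiv_norm L2norm_conjv L2norm_scal_conj. Qed.

(* Both sides of Green's formula are continuous in the H^1 norm of [t]. *)
Lemma H10_green (g : vfield R * cfun R) t : Hdiv Omega g -> H10 Omega t ->
  cintegral Omega (fun x => dot (g.1 x) (t.2 x)) =
  - cintegral Omega (fun x => g.2 x * t.1 x).
Proof.
move=> [g1 g2 green] [t1 t2 [phi [tphi cv1 cv2]]].
have c1 : csquare_int Omega t.1 by exact/L2_scal.
have cg2 : csquare_int Omega g.2 by exact/L2_scal.
apply/eqP; rewrite -subr_eq0 opprK; apply/eqP/Normc.eq0_normc.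
set X := _ + _; apply/eqP; rewrite eq_le normc_ge0 andbT.
pose e k := L2norm Omega Omega g.1 * L2norm Omega Omega (grad (phi k) - t.2) +
  L2norm Omega Omega (scal g.2) * L2norm Omega Omega (scal (phi k - t.1)).
have e0 : e @ \oo --> (0 : R).
  rewrite -[X in _ --> X]addr0 -[X in X + _](mulr0 (L2norm Omega Omega g.1)).
  rewrite -[X in _ + X](mulr0 (L2norm Omega Omega (scal g.2))).
  by apply: cvgD; apply: cvgMl_tmp.
apply: (ler_cvg_to (cvg_cst (normc X)) e0).
apply: nearW => k.
have tk := tphi k; have gk := L2_grad_test tk.
have ck : csquare_int Omega (phi k) by exact/csquare_int_test/test_functionT/tk.
have L2a : L2 Omega (grad (phi k) - t.2) by exact: L2B.
have L2b : L2 Omega (scal (phi k - t.1)).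
  apply/L2_scal; rewrite (_ : _ - _ = fun x => phi k x + (-1) * t.1 x).
    by apply: csquare_intD => //; exact: csquare_intZ.
  by apply/funext => x; rewrite mulN1r.
have E1 : cintegral Omega (fun x => bdot (g.1 x) ((grad (phi k) - t.2) x)) =
  cintegral Omega (fun x => dot (g.1 x) (grad (phi k) x)) -
  cintegral Omega (fun x => dot (g.1 x) (t.2 x)).
  have := cintegral_bdot_lin (-1) t2 gk g1; rewrite mulN1r addrC.
  rewrite (eq_cintegral (f := fun x => bdot (grad (phi k) x) (g.1 x))
    (g := fun x => dot (g.1 x) (grad (phi k) x))); last first.
    by move=> x _; exact: bdotC.
  rewrite (eq_cintegral (f := fun x => bdot (t.2 x) (g.1 x))
    (g := fun x => dot (g.1 x) (t.2 x))); last by move=> x _; exact: bdotC.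
  move=> <-; apply: eq_cintegral => x _.
  by rewrite bdotC scaleN1r addrC.
have E2 : cintegral Omega (fun x => bdot (scal g.2 x) (scal (phi k - t.1) x)) =
  cintegral Omega (fun x => g.2 x * phi k x) -
  cintegral Omega (fun x => g.2 x * t.1 x).
  rewrite -[- cintegral _ _]mulN1r -cintegralZ//; last exact: csquare_intM.
  rewrite -cintegralD//; [|exact: csquare_intM|exact/cintegrableZ/csquare_intM].
  by apply: eq_cintegral => x _; rewrite /bdot big_ord1 !mxE mulN1r mulrBr.
(* Green's formula is exact for [phi k], so only the approximation errors remain. *)
have -> : X = - (cintegral Omega (fun x => bdot (g.1 x) ((grad (phi k) - t.2) x)) +
    cintegral Omega (fun x => bdot (scal g.2 x) (scal (phi k - t.1) x))).
  by rewrite E1 E2 (green _ tk) /X; ring.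
rewrite normcN; apply: le_trans (le_normcD _ _) _.
by apply: lerD; exact: cauchy_schwarz.
Qed.

End Domain.
End VectorFields.

(** * The interpolation error *)

Section LocalToGlobal.
Variable R : realType.
Notation leb := (lebesgue3 R).
Variables (Omega : set (R3 R)) (oO : open Omega).

Let mO : measurable (Omega : set (R3_measurable R)).
Proof. exact: open_measurable3. Qed.

Lemma Rintegral_sum (J : Type) (s : seq J) (f : J -> R3 R -> R) :
  (forall j, rintegrable Omega (f j)) ->
  \int[leb]_(x in Omega) (\sum_(j <- s) f j x) =
  \sum_(j <- s) \int[leb]_(x in Omega) f j x.
Proof.
move=> h; elim: s => [|j s IH].
  under eq_Rintegral do rewrite big_nil.
  by rewrite big_nil Rintegral_cst// mul0r.
rewrite big_cons -IH -RintegralD//; [|exact: h|exact: rintegrable_sum].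
by apply: eq_Rintegral => x _; rewrite big_cons.
Qed.

Lemma rintegrable_indic (A : set (R3 R)) h : measurable (A : set (R3_measurable R)) ->
  (forall x, 0 <= h x) -> rintegrable Omega h -> rintegrable Omega (fun x => \1_A x * h x).
Proof.
move=> mA h0 ih; apply: (rintegrable_dom oO _ ih) => [|x _].
  apply: measurable_funM; last exact: rintegrable_measurable.
  exact: (@measurable_indic _ (R3_measurable R)).
rewrite indicE; case: (x \in A); rewrite ?mul1r ?mul0r ?normr0//.
by rewrite ger0_norm.
Qed.

(** Inside a single integral the density is weighted by the number of sets [A j] that contain the
    point. A weight of at least 1 (covering) or at most N (overlap) then compares the sum with the
    global norm. *)
Lemma sum_sqr_L2norm (J : finType) (A : J -> set (R3 R)) m n
    (f : R3 R -> 'M[R[i]]_(m, n)) :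
  (forall j, measurable (A j : set (R3_measurable R))) -> L2 Omega f ->
  \sum_j L2norm Omega (A j) f ^+ 2 =
  \int[leb]_(x in Omega) (\sum_j \1_(A j) x * csqnorm (f x)).
Proof.
move=> mA [_ f2]; rewrite Rintegral_sum; last first.
  by move=> j; apply: rintegrable_indic => // x; exact: csqnorm_ge0.
apply: eq_bigr => j _; rewrite sqr_L2norm Rintegral_mkcondl.
apply: eq_Rintegral => x _; rewrite patchE indicE.
by case: (x \in A j); rewrite ?mul1r ?mul0r.
Qed.

Lemma sqr_L2norm_le_sum (J : finType) (A : J -> set (R3 R)) m n
    (f : R3 R -> 'M[R[i]]_(m, n)) :
  (forall j, measurable (A j : set (R3_measurable R))) -> L2 Omega f ->
  (forall x, Omega x -> exists j, A j x) ->
  L2norm Omega Omega f ^+ 2 <= \sum_j L2norm Omega (A j) f ^+ 2.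
Proof.
move=> mA f2 cover; rewrite sum_sqr_L2norm// sqr_L2norm_total.
have if2 : rintegrable Omega (fun x => csqnorm (f x)) by case: f2.
apply: le_Rintegral; [exact: mO|exact: if2| |].
  by apply: rintegrable_sum => // j; apply: rintegrable_indic => // x; exact: csqnorm_ge0.
move=> x /cover[j jx]; rewrite -mulr_suml ler_peMl ?csqnorm_ge0//.
rewrite (bigD1 j)//= indicE mem_set// lerDl.
by apply: sumr_ge0 => k _; rewrite indicE.
Qed.

Lemma sum_sqr_L2norm_le (J : finType) (A : J -> set (R3 R)) m n (N : nat)
    (f : R3 R -> 'M[R[i]]_(m, n)) :
  (forall j, measurable (A j : set (R3_measurable R))) -> L2 Omega f ->
  (forall x, Omega x -> (#|[set j | `[< A j x >]]%SET| <= N)%N) ->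
  \sum_j L2norm Omega (A j) f ^+ 2 <= N%:R * L2norm Omega Omega f ^+ 2.
Proof.
move=> mA f2 overlap; rewrite sum_sqr_L2norm// sqr_L2norm_total.
have if2 : rintegrable Omega (fun x => csqnorm (f x)) by case: f2.
rewrite -RintegralZl//; apply: le_Rintegral; [exact: mO| |exact: rintegrableZ|]; last first.
  move=> x /overlap Nx; rewrite -mulr_suml ler_wpM2r ?csqnorm_ge0//.
  apply: le_trans (_ : #|[set j | `[< A j x >]]%SET|%:R <= _); last by rewrite ler_nat.
  rewrite -sum1_card natr_sum [leRHS]big_mkcond /=.
  apply: ler_sum => j _; rewrite indicE [X in if X then _ else _]inE.
  have -> : (x \in A j) = `[< A j x >] by apply/idP/asboolP => [/set_mem|/mem_set].
  by case: `[< A j x >].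
by apply: rintegrable_sum => // j; apply: rintegrable_indic => // x; exact: csqnorm_ge0.
Qed.

End LocalToGlobal.

(** * Global bounds of the regular decomposition and the dual estimate of v - pi v *)

Section QuasiInterpolation.
Variables (R : realType) (c_shape c_unif Cz Ctheta : R).
Variables (Omega : set (R3 R)) (I : finType) (vert : I -> 'I_4 -> R3 R).
Hypotheses (polyO : polyhedral_lipschitz_domain Omega)
  (regO : regular_partition vert Omega)
  (shapeO : shape_regular vert c_shape) (unifO : quasi_uniform vert c_unif).
Notation normc := Normc.normc.
Notation H := (mesh_size vert).
Notation M := (overlap_bound c_shape c_unif).

Let oO : open Omega. Proof. by case: polyO. Qed.
Let bO : bounded_set Omega. Proof. by case: polyO. Qed.

Lemma elt_cover x : Omega x -> exists i, elt vert i x.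
Proof.
have [_ cover _ _] := regO.
by move=> /(@subset_closure _ Omega); rewrite cover => -[i _ ix]; exists i.
Qed.

(** The maximum over an empty mesh would be 0; contractibility provides a point of Omega, and the
    cover an element containing it. *)
Lemma mesh_size_gt0 : 0 < H.
Proof.
have [_ _ [_ [x [/elt_cover[i _] _ _ _ _]]] _ _] := polyO.
have [int0 _ _ _] := regO.
exact: lt_le_trans (diam_gt0 (bounded_elt vert i) (int0 i)) (diam_le_mesh_size vert i).
Qed.

Lemma local_to_global m n m1 n1 m2 n2 (f : R3 R -> 'M[R[i]]_(m, n))
    (g1 : R3 R -> 'M[R[i]]_(m1, n1)) (g2 : R3 R -> 'M[R[i]]_(m2, n2)) (c h : R) :
  L2 Omega f -> L2 Omega g1 -> L2 Omega g2 ->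
  (forall i, L2norm Omega (elt vert i) f <=
    c * (L2norm Omega (npatch vert 3 (elt vert i)) g1 +
         h * L2norm Omega (npatch vert 3 (elt vert i)) g2)) ->
  L2norm Omega Omega f ^+ 2 <= 2 * M%:R * c ^+ 2 *
    (L2norm Omega Omega g1 ^+ 2 + h ^+ 2 * L2norm Omega Omega g2 ^+ 2).
Proof.
move=> f2 g12 g22 loc.
have mE i : measurable (elt vert i : set (R3_measurable R)).
  by apply: (@closed_measurable3 R (elt vert i)); exact: closed_simplex.
have mN i : measurable (npatch vert 3 (elt vert i) : set (R3_measurable R)).
  by apply: (@open_measurable3 R (npatch vert 3 (elt vert i))); exact: open_npatch.
have ov x : Omega x ->
    (#|[set i | `[< npatch vert 3 (elt vert i) x >]]%SET| <= M)%N.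
  by move=> _; exact: overlap_le regO shapeO unifO.
apply: le_trans (sqr_L2norm_le_sum oO mE f2 elt_cover) _.
have b1 := sum_sqr_L2norm_le oO mN g12 ov.
have b2 := sum_sqr_L2norm_le oO mN g22 ov.
apply: (@le_trans _ _ (\sum_i 2 * c ^+ 2 *
   (L2norm Omega (npatch vert 3 (elt vert i)) g1 ^+ 2 +
    h ^+ 2 * L2norm Omega (npatch vert 3 (elt vert i)) g2 ^+ 2))).
  apply: ler_sum => i _; have := loc i.
  move: (L2norm _ (elt vert i) f) (L2norm_ge0 Omega f (elt vert i)) => a a0.
  move: (L2norm _ _ g1) (L2norm _ _ g2) => p q apq.
  (* The right-hand base dominates a >= 0, so squaring is monotone whatever the sign of [c]. The
     factor 2 then comes from (p + h q)^2 <= 2 (p^2 + h^2 q^2). *)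
  have : a ^+ 2 <= (c * (p + h * q)) ^+ 2.
    by rewrite ler_sqr ?nnegrE// (le_trans a0).
  have := sqr_ge0 (c * (p - h * q)); lra.
rewrite -mulr_sumr big_split /= -mulr_sumr.
have -> : 2 * M%:R * c ^+ 2 * (L2norm Omega Omega g1 ^+ 2 +
    h ^+ 2 * L2norm Omega Omega g2 ^+ 2) = 2 * c ^+ 2 *
    (M%:R * L2norm Omega Omega g1 ^+ 2 +
     h ^+ 2 * (M%:R * L2norm Omega Omega g2 ^+ 2)) by ring.
apply: ler_wpM2l; first by apply: mulr_ge0; rewrite ?sqr_ge0.
by apply: lerD b1 _; apply: ler_wpM2l b2; exact: sqr_ge0.
Qed.

(** The root is the factor produced by [local_to_global]; the absolute values make the constant
    nonnegative for arbitrary real [Cz] and [Ctheta]. *)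
Definition interpolation_constant : R :=
  (`|Cz| + `|Ctheta|) * Num.sqrt (2 * M%:R).

Lemma interpolation_constant_ge0 : 0 <= interpolation_constant.
Proof. by rewrite mulr_ge0 ?addr_ge0 ?sqrtr_ge0. Qed.

Lemma Hcurl_norm_ge0 v : 0 <= Hcurl_norm Omega v.
Proof. exact: sqrtr_ge0. Qed.

Lemma Hdiv_norm_ge0 v : 0 <= Hdiv_norm Omega v.
Proof. exact: sqrtr_ge0. Qed.

Lemma sqr_Hcurl_norm v : Hcurl_norm Omega v ^+ 2 =
  L2norm Omega Omega v.2 ^+ 2 + L2norm Omega Omega v.1 ^+ 2.
Proof. by rewrite sqr_sqrtr// addr_ge0 ?sqr_ge0. Qed.

Lemma L2norm_le_Hcurl_norm v : L2norm Omega Omega v.1 <= Hcurl_norm Omega v.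
Proof.
rewrite -ler_sqr ?nnegrE ?L2norm_ge0 ?Hcurl_norm_ge0// sqr_Hcurl_norm.
by rewrite lerDr sqr_ge0.
Qed.

Lemma L2norm_curl_le_Hcurl_norm v : L2norm Omega Omega v.2 <= Hcurl_norm Omega v.
Proof.
rewrite -ler_sqr ?nnegrE ?L2norm_ge0 ?Hcurl_norm_ge0// sqr_Hcurl_norm.
by rewrite lerDl sqr_ge0.
Qed.

Lemma L2norm_le_Hdiv_norm v : L2norm Omega Omega v.1 <= Hdiv_norm Omega v.
Proof.
by rewrite -[leLHS]ger0_norm ?L2norm_ge0// -sqrtr_sqr ler_wsqrtr// lerDl sqr_ge0.
Qed.

Lemma L2norm_div_le_Hdiv_norm v :
  L2norm Omega Omega (scal v.2) <= Hdiv_norm Omega v.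
Proof.
by rewrite -[leLHS]ger0_norm ?L2norm_ge0// -sqrtr_sqr ler_wsqrtr// lerDr sqr_ge0.
Qed.

(* For [H <= 1] the gradient part is integrated by parts and [theta] is small in
   L2; for [H > 1] its gradient is already bounded by [H] times the H(curl) norm,
   which keeps the constant independent of the size of [Omega]. *)
Lemma interpolation_error piE v g : regular_decomposition vert Omega Cz Ctheta piE ->
  Hcurl0 Omega v -> L2 Omega (piE v).1 -> Hdiv Omega g ->
  normc (cintegral Omega (fun x => dot (v.1 x - (piE v).1 x) (g.1 x))) <=
  H * interpolation_constant * Hcurl_norm Omega v * Hdiv_norm Omega g.
Proof.
move=> dec v0 pv2 gdiv.
have [z [Dz [theta [Dtheta [z10 t10 veq bz bt]]]]] := dec v v0.
have [[v12 v22 _] _] := v0; have [g12 g22 _] := gdiv.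
have [t2 Dt2 _] := t10; rewrite /= in t2 Dt2.
have z2 : L2 Omega z.
  apply/(L2P oO) => i j; rewrite ord1.
  by have [/(L2_scal oO)] := z10 i.
have H0 := mesh_size_gt0.
pose s : R := Num.sqrt (2 * M%:R); have s0 : 0 <= s by exact: sqrtr_ge0.
have s2 : s ^+ 2 = 2 * M%:R by rewrite sqr_sqrtr.
set N := Hcurl_norm Omega v.
have N0 : 0 <= N by exact: Hcurl_norm_ge0.
have Nv := sqr_Hcurl_norm v; rewrite -/N in Nv.
have normz : L2norm Omega Omega z <= H * (`|Cz| * s) * N.
  (* The bound of [z] involves only the curl, so it fits [local_to_global] with h = 0. *)
  have locz i : L2norm Omega (elt vert i) z <= (H * Cz) *
      (L2norm Omega (npatch vert 3 (elt vert i)) v.2 +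
       0 * L2norm Omega (npatch vert 3 (elt vert i)) v.2).
    rewrite mul0r addr0 -mulrA -ler_pdivrMl//; apply: le_trans (bz i).
    by rewrite lerDl L2norm_ge0.
  have := local_to_global z2 v22 v22 locz.
  rewrite expr0n mul0r addr0 -s2 => h.
  rewrite -ler_sqr ?nnegrE ?L2norm_ge0 ?mulr_ge0 ?(ltW H0)//.
  apply: le_trans h _; rewrite !exprMn -[`|Cz| ^+ 2]real_normK ?num_real// Nv.
  rewrite normr_id real_normK ?num_real//.
  have := mulr_ge0 (mulr_ge0 (sqr_ge0 H) (sqr_ge0 Cz)) (sqr_ge0 s).
  have := sqr_ge0 (L2norm Omega Omega v.1); nra.
(* The bracket of [local_to_global] with h = H. It is at most N^2 or (H N)^2 according to the size
   of H, which is what separates the two treatments of the gradient part. *)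
pose Q := L2norm Omega Omega v.1 ^+ 2 + H ^+ 2 * L2norm Omega Omega v.2 ^+ 2.
have locDt i : L2norm Omega (elt vert i) Dtheta <= Ctheta *
    (L2norm Omega (npatch vert 3 (elt vert i)) v.1 +
     H * L2norm Omega (npatch vert 3 (elt vert i)) v.2).
  apply: le_trans (bt i); rewrite lerDr mulr_ge0 ?invr_ge0 ?L2norm_ge0//.
  exact: ltW.
have loct i : L2norm Omega (elt vert i) (scal theta) <= (H * Ctheta) *
    (L2norm Omega (npatch vert 3 (elt vert i)) v.1 +
     H * L2norm Omega (npatch vert 3 (elt vert i)) v.2).
  rewrite -mulrA -ler_pdivrMl//; apply: le_trans (bt i).
  by rewrite lerDl L2norm_ge0.
have sqDt := local_to_global Dt2 v12 v22 locDt.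
have sqt := local_to_global t2 v12 v22 loct.
rewrite -s2 in sqDt sqt.
have Q_le1 : H <= 1 -> Q <= N ^+ 2.
  move=> H1; rewrite Nv /Q addrC lerD2r ler_piMl ?sqr_ge0//.
  by rewrite expr_le1// ltW.
have Q_ge1 : 1 <= H -> Q <= (H * N) ^+ 2.
  move=> H1; rewrite exprMn Nv /Q mulrDr addrC lerD2l ler_peMl ?sqr_ge0//.
  by rewrite expr_ge1// ltW.
have gradpart : normc (cintegral Omega (fun x => bdot (Dtheta x) (g.1 x))) <=
    H * (`|Ctheta| * s) * N * Hdiv_norm Omega g.
  have [H1|H1] := leP H 1.
    rewrite (eq_cintegral (g := fun x => dot (g.1 x) ((theta, Dtheta).2 x))); last first.
      by move=> x _; exact: bdotC.
    rewrite (H10_green oO bO gdiv t10) normcN.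
    rewrite (eq_cintegral (g := fun x => bdot (scal theta x) (scal g.2 x))); last first.
      by move=> x _; rewrite /bdot big_ord1 !mxE mulrC.
    apply: le_trans (cauchy_schwarz oO t2 g22) _.
    apply: ler_pM; rewrite ?L2norm_ge0 ?L2norm_div_le_Hdiv_norm//.
    rewrite -ler_sqr ?nnegrE ?L2norm_ge0 ?mulr_ge0 ?(ltW H0)//.
    apply: le_trans sqt _; rewrite !exprMn real_normK ?num_real//.
    have -> : H ^+ 2 * (Ctheta ^+ 2 * s ^+ 2) * N ^+ 2 =
      s ^+ 2 * (H ^+ 2 * Ctheta ^+ 2) * N ^+ 2 by ring.
    apply: ler_wpM2l; last exact: Q_le1.
    by apply: mulr_ge0; [|apply: mulr_ge0]; exact: sqr_ge0.
  apply: le_trans (cauchy_schwarz oO Dt2 g12) _.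
  apply: ler_pM; rewrite ?L2norm_ge0 ?L2norm_le_Hdiv_norm//.
  rewrite -ler_sqr ?nnegrE ?L2norm_ge0 ?mulr_ge0 ?(ltW H0)//.
  apply: le_trans sqDt _; rewrite !exprMn real_normK ?num_real//.
  have -> : H ^+ 2 * (Ctheta ^+ 2 * s ^+ 2) * N ^+ 2 =
    s ^+ 2 * Ctheta ^+ 2 * (H * N) ^+ 2 by ring.
  apply: ler_wpM2l; last by apply: Q_ge1; exact: ltW.
  by apply: mulr_ge0; exact: sqr_ge0.
have zpart : normc (cintegral Omega (fun x => bdot (z x) (g.1 x))) <=
    H * (`|Cz| * s) * N * Hdiv_norm Omega g.
  apply: le_trans (cauchy_schwarz oO z2 g12) _.
  by apply: ler_pM; rewrite ?L2norm_ge0 ?L2norm_le_Hdiv_norm.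
rewrite [cintegral _ _](_ : _ = cintegral Omega (fun x => bdot (z x) (g.1 x)) +
    cintegral Omega (fun x => bdot (Dtheta x) (g.1 x))); last first.
  rewrite -(cintegralD oO (cintegrable_bdot oO z2 g12) (cintegrable_bdot oO Dt2 g12)).
  apply: (ae_eq_cintegral oO).
  - exact: (cintegrable_bdot oO (L2B oO v12 pv2) g12).
  - exact: (cintegrableD oO (cintegrable_bdot oO z2 g12) (cintegrable_bdot oO Dt2 g12)).
  have ? := lebesgue3_ae_filter R.
  move: veq; apply: filterS => x /[apply] e.
  rewrite -bdotDl; congr (bdot _ _); exact: e.
apply: le_trans (le_normcD _ _) _; apply: le_trans (lerD zpart gradpart) _.
by rewrite /interpolation_constant -/s; lra.
Qed.

End QuasiInterpolation.

(** * The corrector *)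

Section Form.
Variable R : realType.
Notation normc := Normc.normc.
Notation leb := (lebesgue3 R).
Variables (Omega : set (R3 R)) (oO : open Omega) (bO : bounded_set Omega).
Variables (mu : R3 R -> 'M[R]_3) (kappa : R3 R -> 'M[R[i]]_3).
Hypothesis coeff : coefficients Omega mu kappa.
Implicit Types (v w psi : vfield R * vfield R).

Lemma conjv_lin a (u u' : 'cV[R[i]]_3) :
  conjv (a *: u + u') = conjc a *: conjv u + conjv u'.
Proof. by apply/matrixP => i j; rewrite !mxE rmorphD rmorphM. Qed.

Lemma inner_linl a (f f' g : vfield R) : L2 Omega f -> L2 Omega f' -> L2 Omega g ->
  inner Omega (fun x => a *: f x + f' x) g = a * inner Omega f g + inner Omega f' g.
Proof. by move=> f2 f'2 g2; exact: (cintegral_bdot_lin oO a f2 f'2 (L2J oO g2)). Qed.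

Lemma inner_linr a (f g g' : vfield R) : L2 Omega f -> L2 Omega g -> L2 Omega g' ->
  inner Omega f (a *: g + g') = conjc a * inner Omega f g + inner Omega f g'.
Proof.
move=> f2 g2 g'2.
have E (h : vfield R) :
    inner Omega f h = cintegral Omega (fun x => bdot (conjv (h x)) (f x)).
  by apply: eq_cintegral => x _; exact: bdotC.
rewrite !E -(cintegral_bdot_lin oO (conjc a) (L2J oO g2) (L2J oO g'2) f2).
by apply: eq_cintegral => x _; rewrite -conjv_lin.
Qed.

Lemma normc_inner_le (f g : vfield R) : L2 Omega f -> L2 Omega g ->
  normc (inner Omega f g) <= L2norm Omega Omega f * L2norm Omega Omega g.
Proof.
move=> f2 g2; rewrite -[L2norm _ _ g]L2norm_conjv.
exact: (cauchy_schwarz oO f2 (L2J oO g2)).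
Qed.

Lemma L2_mulmx (A : R3 R -> 'M[R[i]]_3) (f : vfield R) :
  (forall i j, Linfty Omega (fun x => complex.Re (A x i j)) /\
               Linfty Omega (fun x => complex.Im (A x i j))) ->
  L2 Omega f -> L2 Omega (fun x => A x *m f x).
Proof.
move=> bA /(L2P oO) f2; apply/(L2P oO) => i j.
under [X in csquare_int _ X]funext do rewrite mxE.
apply: csquare_int_sum => // k; have [bA1 bA2] := bA i k.
exact: csquare_int_Linfty.
Qed.

Lemma L2_mu (f : vfield R) : L2 Omega f ->
  L2 Omega (fun x => map_mx (real_complex R) (mu x) *m f x).
Proof.
apply: L2_mulmx => i j; have [bmu _ _] := coeff i j; split.
  by under [X in Linfty _ X]funext do rewrite mxE.
under [X in Linfty _ X]funext do rewrite mxE.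
split; first exact: measurable_cst.
by exists 0; apply: aeW => x _; rewrite normr0.
Qed.

Lemma L2_kappa (f : vfield R) : L2 Omega f -> L2 Omega (fun x => kappa x *m f x).
Proof. by apply: L2_mulmx => i j; have [] := coeff i j. Qed.

Lemma form_linl a v w psi : Hcurl Omega v -> Hcurl Omega w -> Hcurl Omega psi ->
  Defs.form Omega mu kappa (a *: v + w) psi =
  a * Defs.form Omega mu kappa v psi + Defs.form Omega mu kappa w psi.
Proof.
move=> [v1 v2 _] [w1 w2 _] [p1 p2 _]; rewrite /Defs.form mulrDr addrACA.
rewrite -(inner_linl _ (L2_mu v2) (L2_mu w2) p2).
rewrite -(inner_linl _ (L2_kappa v1) (L2_kappa w1) p1).
by congr (_ + _); apply: eq_cintegral => x _; rewrite mulmxDr -scalemxAr.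
Qed.

(** [corrector_green] specifies [G] only on bounded antilinear functionals, so this gives access to
    the corrector. The bound found here depends on the coefficients but stays out of the error
    constant. *)
Lemma form_dual v : Hcurl Omega v -> Hcurl0_dual Omega (Defs.form Omega mu kappa v).
Proof.
move=> [v1 v2 _]; have m2 := L2_mu v2; have k2 := L2_kappa v1; split.
  move=> a w psi [[w1 w2 _] _] [[p1 p2 _] _].
  by rewrite /Defs.form /= !inner_linr//; ring.
exists (L2norm Omega Omega (fun x => map_mx (real_complex R) (mu x) *m v.2 x) +
  L2norm Omega Omega (fun x => kappa x *m v.1 x)) => w [[w1 w2 _] _].
apply: le_trans (le_normcD _ _) _; rewrite mulrDl; apply: lerD.
  apply: le_trans (normc_inner_le m2 w2) _.
  by apply: ler_wpM2l; [exact: L2norm_ge0|exact: L2norm_curl_le_Hcurl_norm].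
apply: le_trans (normc_inner_le k2 w1) _.
by apply: ler_wpM2l; [exact: L2norm_ge0|exact: L2norm_le_Hcurl_norm].
Qed.

Lemma Hdiv_dual_norm_le (w : vfield R) (b : R) : 0 <= b ->
  (forall g, Hdiv Omega g -> normc (cintegral Omega (fun x => dot (w x) (g.1 x)))
    <= b * Hdiv_norm Omega g) ->
  Hdiv_dual_norm Omega w <= b.
Proof.
move=> b0 h; rewrite /Hdiv_dual_norm; set S := [set r | _].
(* Without a field of norm 1 the supremum takes its default value 0, which is covered by 0 <= b. *)
have [->|/set0P S0] := eqVneq S set0; first by rewrite sup0.
apply: ge_sup => // _ [g [gdiv g1 ->]].
by rewrite -[b]mulr1 -g1; exact: h.
Qed.

Lemma Hcurl_norm_weak_solution_le alpha f u : 0 < alpha ->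
  coercive Omega mu kappa alpha -> Hdiv Omega f ->
  weak_solution Omega mu kappa f.1 u ->
  alpha * Hcurl_norm Omega u <= Hdiv_norm Omega f.
Proof.
move=> a0 coer [f1 _ _] [u0 uf].
have [[u1 _ _] _] := u0; have := coer _ u0; rewrite uf// => h.
have := le_trans h (normc_inner_le f1 u1).
have u1N := L2norm_le_Hcurl_norm Omega u; have f1N := L2norm_le_Hdiv_norm Omega f.
have N0 := Hcurl_norm_ge0 Omega u.
move=> {}h; have [->|Nn0] := eqVneq (Hcurl_norm Omega u) 0.
  by rewrite mulr0 Hdiv_norm_ge0.
have Np : 0 < Hcurl_norm Omega u by rewrite lt_neqAle eq_sym Nn0.
rewrite -(ler_pM2r Np) -mulrA -expr2; apply: le_trans h _.
by apply: ler_pM => //; exact: L2norm_ge0.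
Qed.

End Form.

(** * The error of the corrected coarse part *)

Section Corrector.
Variables (R : realType) (Omega : set (R3 R)) (oO : open Omega).
Variables (mu : R3 R -> 'M[R]_3) (kappa : R3 R -> 'M[R[i]]_3).
Hypothesis coeff : coefficients Omega mu kappa.
Notation leb := (lebesgue3 R).
Notation W := (vfield R * vfield R)%type.
Variables (bO : bounded_set Omega) (piE : W -> W) (S : set W)
  (G : (W -> R[i]) -> W).
Hypotheses (piP : linear_projection Omega (Hcurl0 Omega) S piE)
  (SH : S `<=` Hcurl0 Omega)
  (GP : corrector_green Omega mu kappa piE G).

Variable u : W.
Hypothesis u0 : Hcurl0 Omega u.

Let e : W := u - (piE u + corrector Omega mu kappa G (piE u)).

Let p0 : Hcurl0 Omega (piE u).
Proof. by have [h _ _ _] := piP; exact/SH/h. Qed.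

Let pH : Hcurl Omega (piE u). Proof. by case: p0. Qed.

Let dualP := form_dual oO coeff pH.

Let g : W := G (Defs.form Omega mu kappa (piE u)).

Let g0 : Hcurl0 Omega g. Proof. by have [[]] := GP dualP. Qed.

(** The nested shape a *: v + w is the one in which linearity of [piE], of the form and of H_0(curl)
    is stated. *)
Let error_eq : e = (-1) *: piE u + (1 *: u + g).
Proof. by rewrite /e /corrector -/g scaleN1r scale1r opprD opprK addrCA. Qed.

Lemma corrector_error_Hcurl0 : Hcurl0 Omega e.
Proof.
by rewrite error_eq; apply: (Hcurl0_lin oO bO) => //; exact: (Hcurl0_lin oO bO).
Qed.

(** By linearity pi e = - pi (pi u) + pi u + pi g, where the first two terms cancel since pi u lies
    in the range of the projection, and pi g = 0 since [G] maps into its kernel. *)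
Lemma piE_corrector_error : ae_eq leb Omega (piE e).1 0.
Proof.
have [mapsto _ lin idS] := piP.
have ug0 : Hcurl0 Omega (1 *: u + g) by exact: (Hcurl0_lin oO bO).
have l1 := lin (-1) _ _ p0 ug0; have l2 := lin 1 _ _ u0 g0.
have l3 := idS _ (mapsto _ u0); have [[_ l4] _] := GP dualP.
rewrite -error_eq in l1.
have ? := lebesgue3_ae_filter R.
apply: filterS (filterI (filterI l1 l2) (filterI l3 l4)) => x [[h1 h2] [h3 h4]] Ox.
have {}h1 := h1 Ox; have {}h2 := h2 Ox; have {}h3 := h3 Ox; have {}h4 := h4 Ox.
rewrite h1 -[RHS](addNr ((piE u).1 x)) -[X in _ = - X + _]h3.
transitivity (- (piE (piE u)).1 x + (piE (1 *: u + g)).1 x).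
  by rewrite -[- (piE (piE u)).1 x]scaleN1r.
rewrite h2; congr (- _ + _).
transitivity (1 *: (piE u).1 x + (piE g).1 x) => //.
by rewrite h4 addr0 scale1r.
Qed.

Lemma form_corrector_error (f : vfield R) :
  (forall psi, Hcurl0 Omega psi -> Defs.form Omega mu kappa u psi = inner Omega f psi.1) ->
  Defs.form Omega mu kappa e e = inner Omega f e.1.
Proof.
move=> uf.
have e0 := corrector_error_Hcurl0.
have eW : kernelW Omega piE e by split => //; exact: piE_corrector_error.
have [_ /(_ e eW) ge] := GP dualP; rewrite -/g in ge.
have [eH _] := e0; have [uH _] := u0; have [gH _] := g0.
have [ugH _] : Hcurl0 Omega (1 *: u + g) by exact: (Hcurl0_lin oO bO).
(* Only the first argument is expanded: the second must remain [e], an element of the kernel, for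
   the terms B(pi u, e) and B(g, e) to cancel. *)
rewrite {1}error_eq !(form_linl oO coeff)// ge uf//.
by rewrite mul1r mulN1r addrCA addNr addr0.
Qed.

End Corrector.

(** * Assembling the three error bounds *)

Theorem mainTheorem4 (R : realType) (alpha c_shape c_unif Cz Ctheta : R) :
  0 < alpha ->
  exists C : R,
  forall (Omega : set (R3 R)) (mu : R3 R -> 'M[R]_3) (kappa : R3 R -> 'M[R[i]]_3)
    (I : finType) (vert : I -> 'I_4 -> R3 R) (Cpi : R)
    (piE : vfield R * vfield R -> vfield R * vfield R)
    (G : (vfield R * vfield R -> R[i]) -> vfield R * vfield R)
    (f : vfield R * cfun R) (u : vfield R * vfield R),
  polyhedral_lipschitz_domain Omega ->
  coefficients Omega mu kappa ->
  coercive Omega mu kappa alpha ->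
  regular_partition vert Omega ->
  shape_regular vert c_shape ->
  quasi_uniform vert c_unif ->
  falk_winther vert Omega Cpi piE ->
  regular_decomposition vert Omega Cz Ctheta piE ->
  corrector_green Omega mu kappa piE G ->
  Hdiv Omega f ->
  weak_solution Omega mu kappa f.1 u ->
  let H := mesh_size vert in
  let K := corrector Omega mu kappa G in
  let uH := piE u in
  H^-1 * Hdiv_dual_norm Omega (u - (uH + K uH)).1 +
  Hcurl_norm Omega (u - (uH + K uH)) +
  Hdiv_dual_norm Omega (u - uH).1
    <= C * H * Hdiv_norm Omega f.
Proof.
move=> a0; set c := interpolation_constant c_shape c_unif Cz Ctheta.
(* The scaled dual norm of e contributes c^2 / alpha; its H(curl) norm and the dual norm of u - u_H
   contribute c / alpha each. *)
exists ((c ^+ 2 + 2 * c) / alpha).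
move=> Omega mu kappa I vert Cpi piE G f u polyO coeff coer regO shapeO unifO.
move=> [piP _ _ _] dec GP fdiv weak; cbv zeta.
set H := mesh_size vert; set uH := piE u; set K := corrector Omega mu kappa G.
have [oO bO _ _ _] := polyO; have [u0 uf] := weak.
have [f1 _ _] := fdiv.
have H0 : 0 < H by exact: (mesh_size_gt0 polyO regO).
have c0 : 0 <= c by exact: interpolation_constant_ge0.
have SH : nedelec0 vert Omega `<=` Hcurl0 Omega by move=> v [].
have piL2 v : Hcurl0 Omega v -> L2 Omega (piE v).1.
  by have [h _ _ _] := piP => /h/SH[[]].
have err v g : Hcurl0 Omega v -> Hdiv Omega g ->
    Normc.normc (cintegral Omega (fun x => dot (v.1 x - (piE v).1 x) (g.1 x))) <=
    H * c * Hcurl_norm Omega v * Hdiv_norm Omega g.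
  move=> v0 gdiv.
  exact: (interpolation_error polyO regO shapeO unifO dec v0 (piL2 _ v0) gdiv).
set e := u - (uH + K uH).
have e0 : Hcurl0 Omega e by exact: (corrector_error_Hcurl0 oO coeff bO piP SH GP u0).
have pe0 : ae_eq (lebesgue3 R) Omega (piE e).1 0 :=
  piE_corrector_error oO coeff bO piP SH GP u0.
have ee : Defs.form Omega mu kappa e e = inner Omega f.1 e.1 :=
  form_corrector_error oO coeff bO piP SH GP u0 uf.
have [[e1 _ _] _] := e0.
set F := Hdiv_norm Omega f; have F0 : 0 <= F by exact: Hdiv_norm_ge0.
set N := Hcurl_norm Omega e; have N0 : 0 <= N by exact: Hcurl_norm_ge0.
(* Since pi e vanishes almost everywhere, e and e - pi e have the same pairings. *)
have erre g : Hdiv Omega g ->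
    Normc.normc (cintegral Omega (fun x => dot (e.1 x) (g.1 x))) <=
    H * c * N * Hdiv_norm Omega g.
  move=> gdiv; have [g1 _ _] := gdiv; apply: le_trans (err e g e0 gdiv).
  rewrite le_eqVlt; apply/orP; left; apply/eqP; congr Normc.normc.
  apply: (ae_eq_cintegral oO); first exact: (cintegrable_bdot oO e1 g1).
    exact: (cintegrable_bdot oO (L2B oO e1 (piL2 _ e0)) g1).
  have ? := lebesgue3_ae_filter R.
  by move: pe0; apply: filterS => x h Ox; rewrite h// subr0.
have aN : alpha * N <= H * c * F.
  have [->|Nn0] := eqVneq N 0; first by rewrite mulr0 !mulr_ge0// ltW.
  have Np : 0 < N by rewrite lt_neqAle eq_sym Nn0.
  rewrite -(ler_pM2r Np) -(mulrA alpha) -expr2; apply: le_trans (coer _ e0) _.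
  (* Conjugation preserves the modulus of (f, e) and turns it into the bilinear pairing of e with
     conj f, to which [erre] applies. *)
  rewrite ee -normc_conj /inner -(cintegralJ oO); last first.
    exact: (cintegrable_bdot oO f1 (L2J oO e1)).
  have := erre _ (HdivJ oO bO fdiv); rewrite Hdiv_normJ -/F.
  rewrite mulrAC; apply: le_trans; rewrite le_eqVlt; apply/orP; left; apply/eqP.
  congr Normc.normc; apply: eq_cintegral => x _ /=.
  rewrite [RHS]bdotC /dot rmorph_sum; apply: eq_bigr => i _.
  by rewrite rmorphM /= !mxE conjcK.
have aU := Hcurl_norm_weak_solution_le oO a0 coer fdiv weak; rewrite -/F in aU.
set U := Hcurl_norm Omega u in aU; have U0 : 0 <= U by exact: Hcurl_norm_ge0.
have De : Hdiv_dual_norm Omega e.1 <= H * c * N.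
  by apply: Hdiv_dual_norm_le => //; rewrite !mulr_ge0// ltW.
have Du : Hdiv_dual_norm Omega (u - uH).1 <= H * c * U.
  apply: Hdiv_dual_norm_le => [|g gdiv]; first by rewrite !mulr_ge0// ltW.
  exact: err.
have De' : H^-1 * Hdiv_dual_norm Omega e.1 <= c * N.
  by rewrite ler_pdivrMl// mulrA.
have b1 : N <= H * c * F / alpha by rewrite ler_pdivlMr// mulrC.
have b2 : U <= F / alpha by rewrite ler_pdivlMr// mulrC.
apply: le_trans (lerD (lerD De' (lexx N)) Du) _.
apply: le_trans (lerD (lerD (ler_wpM2l c0 b1) b1)
  (ler_wpM2l (mulr_ge0 (ltW H0) c0) b2)) _.
by rewrite le_eqVlt; apply/orP; left; apply/eqP; ring.
Qed.
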